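(* Let $U$ be an open subset of a complex Banach space $E$ and let $v$ be a weight on $U$. Suppose that $H^\infty_v(U)$ has the $WH^\infty$-BPB property. Then $H^\infty_{vK}(U,F)$ has the $WH^\infty$-BPB property for any complex Lindenstrauss space $F$.
   Context: Notation: $B_X$, $S_X$ are the closed unit ball and unit sphere of a Banach space $X$; $\mathbb{T}$ is the unit circle of $\mathbb{C}$. A weight on $U$ is a strictly positive continuous function on $U$. $H^\infty_v(U,F)$ is the Banach space of holomorphic mappings $f:U\to F$ with $\|f\|_v:=\sup\{v(z)\|f(z)\|: z\in U\}<\infty$; $H^\infty_v(U):=H^\infty_v(U,\mathbb{C})$. $H^\infty_{vK}(U,F)$ is the subspace of all $f\in H^\infty_v(U,F)$ such that $vf$ has relatively compact range in $F$, with the norm $\|\cdot\|_v$. $G^\infty_v(U)$ is the space of all linear functionals on $H^\infty_v(U)$ whose restriction to $B_{H^\infty_v(U)}$ is continuous for the compact-open topology; it is a closed subspace of $H^\infty_v(U)^*$, with the norm of $H^\infty_v(U)^*$. For $z\in U$, $\delta_z\in G^\infty_v(U)$ is the evaluation $\delta_z(f)=f(z)$. $WH^\infty$-BPB property: a linear subspace $A\subseteq H^\infty_v(U,F)$ (possibly the whole space; $F=\mathbb{C}$ for $H^\infty_v(U)$) has the $WH^\infty$-BPB property if for every $0<\varepsilon<1$ there is $0<\eta(\varepsilon)<\varepsilon$ such that for every $f\in S_A$, every $\lambda\in\mathbb{T}$ and every $z\in U$ with $v(z)\|f(z)\|>1-\eta(\varepsilon)$, there exist $f_0\in S_A$, $\lambda_0\in\mathbb{T}$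 and $z_0\in U$ such that $v(z_0)\|f_0(z_0)\|=1$, $\|f-f_0\|_v<\varepsilon$ and $\|\lambda v(z)\delta_z-\lambda_0v(z_0)\delta_{z_0}\|<\varepsilon$ (the last norm being that of $G^\infty_v(U)$). A Banach space $F$ is a Lindenstrauss space if $F^*$ is isometrically isomorphic to an $L_1(\mu)$ space for some measure $\mu$ (here complex scalars). *)

(* Defs.v *)
From HB Require Import structures.
From mathcomp Require Import all_boot all_order all_algebra.
From mathcomp Require Import complex.
From mathcomp Require Import all_classical all_reals all_analysis.
Set Implicit Arguments.
Unset Strict Implicit.
Unset Printing Implicit Defensive.
Import Order.TTheory GRing.Theory Num.Theory.
Import numFieldNormedType.Exports.

Local Open Scope classical_set_scope.
Local Open Scope ring_scope.
Local Open Scope complex_scope.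

(* The norm of a normed module over R[i] takes its values in R[i], where they
   are nonnegative reals; [rnorm] is the same number seen in R. *)
Definition rnorm (R : realType) (V : normedModType R[i]) (x : V) : R :=
  complex.Re `|x|.

Definition weight (R : realType) (E : normedModType R[i]) (U : set E)
    (v : E -> R) : Prop :=
  {within U, continuous v} /\ (forall z, U z -> 0 < v z).

Section weighted_holomorphic.
Context {R : realType} {E F : normedModType R[i]}.
Implicit Types (U : set E) (v : E -> R) (f : E -> F).

(* A mapping U -> F is represented by any total function E -> F extending it;
   as U is open, everything below only depends on its values on U. *)

(* [differentiable] is Frechet differentiability, here over the scalars R[i] *)
Definition holomorphic_on U f : Prop := forall z, U z -> differentiable f z.

Definition vvalues U v f : set R := [set v z * rnorm (f z) | z in U].

Definition vnorm U v f : R := sup (vvalues U v f).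

Definition Hv U v : set (E -> F) :=
  [set f | holomorphic_on U f /\ has_ubound (vvalues U v f)].

Definition HvK U v : set (E -> F) :=
  [set f | Hv U v f /\ precompact [set (v z)%:C *: f z | z in U]].

End weighted_holomorphic.

Section evaluation.
Context {R : realType} {E : normedModType R[i]}.
Implicit Types (U : set E) (v : E -> R).

Definition delta (z : E) : (E -> R[i]^o) -> R[i]^o := fun g => g z.

(* The norm of the dual of Hv U v, which is also that of its subspace
   G^oo_v(U). *)
Definition dual_vnorm U v (phi : (E -> R[i]^o) -> R[i]^o) : R :=
  sup [set rnorm (phi g) | g in [set g | Hv U v g /\ vnorm U v g <= 1]].

End evaluation.

Definition WH_BPB (R : realType) (E F : normedModType R[i]) (U : set E)
    (v : E -> R) (A : set (E -> F)) : Prop :=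
  forall eps : R, 0 < eps < 1 ->
  exists2 eta : R, 0 < eta < eps &
    forall (f : E -> F) (lambda : R[i]) (z : E),
      A f -> vnorm U v f = 1 -> `|lambda| = 1 -> U z ->
      v z * rnorm (f z) > 1 - eta ->
      exists (f0 : E -> F) (lambda0 : R[i]) (z0 : E),
        [/\ [/\ A f0, vnorm U v f0 = 1, `|lambda0| = 1 & U z0],
            v z0 * rnorm (f0 z0) = 1,
            vnorm U v (f - f0) < eps &
            dual_vnorm U v ((lambda * (v z)%:C) *: delta z
                            - (lambda0 * (v z0)%:C) *: delta z0) < eps].

Definition topdual (R : realType) (F : normedModType R[i]) :
    set (F -> R[i]^o) :=
  [set phi : F -> R[i]^o | linear phi /\ continuous phi].

Definition opnorm (R : realType) (F : normedModType R[i])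
    (phi : F -> R[i]^o) : R :=
  sup [set rnorm (phi x) | x in [set x : F | `|x| <= 1]].

Definition L1norm (R : realType) (d : measure_display) (T : measurableType d)
    (mu : {measure set T -> \bar R}) (g : T -> R[i]^o) : \bar R :=
  (\int[mu]_t (rnorm (g t))%:E)%E.

Definition cL1 (R : realType) (d : measure_display) (T : measurableType d)
    (mu : {measure set T -> \bar R}) : set (T -> R[i]^o) :=
  [set g | [/\ measurable_fun setT (fun t => complex.Re (g t)),
               measurable_fun setT (fun t => complex.Im (g t)) &
               (L1norm mu g < +oo)%E]].

(* [Phi] is given on integrable functions rather than on their classes modulo
   equality almost everywhere. Being linear and norm preserving, it takes the
   same value on g and g' iff L1norm mu (g - g') = 0, so it is exactly a
   surjective linear isometry from the quotient L_1(mu) onto the dual of F. *)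
Definition lindenstrauss (R : realType) (F : normedModType R[i]) : Prop :=
  exists (d : measure_display) (T : measurableType d)
         (mu : {measure set T -> \bar R})
         (Phi : (T -> R[i]^o) -> (F -> R[i]^o)),
    [/\ forall g, cL1 mu g -> topdual (Phi g),
        forall (a : R[i]) g h, cL1 mu g -> cL1 mu h ->
          Phi (a *: g + h) = a *: Phi g + Phi h,
        forall g, cL1 mu g -> (opnorm (Phi g))%:E = L1norm mu g &
        forall phi, topdual phi -> exists2 g, cL1 mu g & Phi g = phi].

(* Main.v *)
Require Import Defs.
From HB Require Import structures.
From mathcomp Require Import all_boot all_order all_algebra.
From mathcomp Require Import complex.
From mathcomp Require Import all_classical all_reals all_analysis.
From mathcomp Require Import measurable_realfun.
From mathcomp Require Import ring lra.
Import Order.TTheory GRing.Theory Num.Theory.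
Import numFieldNormedType.Exports.
Local Open Scope classical_set_scope.
Local Open Scope ring_scope.
Local Open Scope complex_scope.
Set Implicit Arguments.
Unset Strict Implicit.
Unset Printing Implicit Defensive.

(* Let phi be an extreme point of the unit ball of the dual L_1(mu) of F with
   phi (f z) = |f z|. Extremality makes phi an atom of L_1(mu), so the dual of F
   is the l1-direct sum of the line spanned by phi and of a complement: ker phi
   is an M-ideal of F. Apply the scalar property to phi o f, normalised; it
   yields g0 attaining its norm at z0. It remains to move f slightly so that phi
   maps it to g0, without leaving the unit ball. By Hahn-Banach separation and
   the l1-decomposition, for finitely many (hence compactly many) pairs (x, a)
   with |x| <= rho and |phi x + a| <= rho there is y with phi y = 1 and all
   |x + a y| <= rho + d. Iterating with geometrically decreasing errors gives y
   and q in F such that x |-> (1 - r) (x - phi x y) + b q maps (v f, v g0) into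
   the unit ball, with phi-image b. The new mapping is
   f0 = (1 - r) (f - (phi o f) y) + g0 q; its norm at z0 is at least
   |phi (f0 z0)| = |g0 z0|. *)

(** * Extreme functionals below a sublinear functional *)

Section sublinear.
Context {R : realType} {V : lmodType R[i]}.
Implicit Types (p q l : V -> R) (x y : V).

Definition sublinear p : Prop :=
  (forall x y, p (x + y) <= p x + p y) /\
  (forall (t : R) x, 0 <= t -> p (t%:C *: x) <= t * p x).

Definition real_linear l : Prop :=
  (forall x y, l (x + y) = l x + l y) /\
  (forall (t : R) x, l (t%:C *: x) = t * l x).

(* The functionals dominated by [q] form a face of those dominated by [p]. *)
Definition face p q : Prop :=
  [/\ sublinear q, forall x, q x <= p x &
      forall l1 l2 (s t : R), real_linear l1 -> real_linear l2 ->
        0 <= s -> 0 <= t -> s + t = 1 ->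
        (forall x, l1 x <= s * p x) -> (forall x, l2 x <= t * p x) ->
        (forall x, l1 x + l2 x <= q x) ->
        (forall x, l1 x <= s * q x) /\ (forall x, l2 x <= t * q x)].

Lemma sublinear0 p : sublinear p -> p 0 = 0.
Proof.
move=> [pD pZ]; apply/eqP; rewrite eq_le; apply/andP; split.
  by have := pZ 0 0 (lexx 0); rewrite scaler0 mul0r.
by have := pD 0 0; rewrite addr0; lra.
Qed.

Lemma sublinearN p x : sublinear p -> - p (- x) <= p x.
Proof.
by move=> ps; have := ps.1 x (- x); rewrite subrr sublinear0//; lra.
Qed.

Lemma real_linearN l x : real_linear l -> l (- x) = - l x.
Proof.
by move=> [_ lZ]; have := lZ (-1) x; rewrite mulN1r raddfN/= scaleN1r.
Qed.

Lemma face_refl p : sublinear p -> face p p.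
Proof. by move=> ps; split. Qed.

(* The largest value at [y] of a functional dominated by [q] and equal to [q]
   at [x]. *)
Definition directional q x y : R :=
  inf [set q (y + t%:C *: x) - t * q x | t in [set t : R | 0 <= t]].

Section directional_theory.
Variables (q : V -> R) (x : V).
Hypothesis qs : sublinear q.

(** From [q (t x) <= q (y + t x) + q (- y)] and [t * q x <= q (t x)]. It makes the infimum in
    [directional] finite. *)
Lemma directional_lb y :
  lbound [set q (y + t%:C *: x) - t * q x | t in [set t : R | 0 <= t]]
         (- q (- y)).
Proof.
move=> _ [t /= t0 <-].
have := qs.1 (y + t%:C *: x) (- y); rewrite addrAC subrr add0r.
have [->|tn0] := eqVneq t 0.
  by rewrite rmorph0 scale0r sublinear0//; lra.
have := qs.2 t^-1 (t%:C *: x); rewrite invr_ge0 => /(_ t0).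
rewrite scalerA -rmorphM mulVf// scale1r => h.
have : t * q x <= t * (t^-1 * q (t%:C *: x)) by rewrite ler_wpM2l.
by rewrite mulrA mulfV// mul1r; lra.
Qed.

Lemma directional_le y (t : R) :
  0 <= t -> directional q x y <= q (y + t%:C *: x) - t * q x.
Proof.
move=> t0; apply: ge_inf; first by exists (- q (- y)); exact: directional_lb.
by exists t.
Qed.

Lemma le_directional y (c : R) :
  (forall t : R, 0 <= t -> c <= q (y + t%:C *: x) - t * q x) ->
  c <= directional q x y.
Proof.
move=> h; apply: lb_le_inf; first by exists (q (y + 0%:C *: x) - 0 * q x), 0 => /=.
by move=> _ [t t0 <-]; exact: h.
Qed.

Lemma directional_le_self y : directional q x y <= q y.
Proof.
by have := directional_le y (lexx 0); rewrite rmorph0 scale0r addr0 mul0r subr0.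
Qed.

(** Take [t = 1]. An odd functional below [directional q x] is thereby at least [q x] at [x]. *)
Lemma directional_oppr : directional q x (- x) <= - q x.
Proof.
have := directional_le (- x) ler01.
by rewrite rmorph1 scale1r addNr sublinear0//; lra.
Qed.

Lemma sublinear_directional : sublinear (directional q x).
Proof.
split=> [y z|s y s0].
  (* A parameter [t] for [y] and a parameter [u] for [z] add up to one for [y + z]. *)
  rewrite -lerBlDr; apply: le_directional => t t0.
  rewrite lerBlDr -lerBlDl; apply: le_directional => u u0.
  have := directional_le (y + z) (addr_ge0 t0 u0).
  rewrite rmorphD scalerDl addrACA => /le_trans; rewrite lerBlDl; apply.
  by have := qs.1 (y + t%:C *: x) (z + u%:C *: x); lra.
have [->|sn0] := eqVneq s 0.
  by rewrite rmorph0 scale0r mul0r (le_trans (directional_le_self _))// sublinear0.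
have s_gt0 : 0 < s by lra.
rewrite -ler_pdivrMl//; apply: le_directional => t t0.
rewrite ler_pdivrMl//.
have := directional_le (s%:C *: y) (mulr_ge0 s0 t0).
rewrite rmorphM -scalerA -scalerDr => /le_trans; apply.
by have := qs.2 s (y + t%:C *: x) s0; rewrite mulrBr mulrA; lra.
Qed.

End directional_theory.

(** If [l1 + l2] lies below [directional q x], it is at least [q x] at [x], so the face inequalities
    for [q] are equalities there. Subtracting [c] times these from the inequalities at [y + c x]
    gives the sharper bounds. *)
Lemma face_directional p q x : face p q -> face p (directional q x).
Proof.
move=> [qs qp qf]; split.
- exact: sublinear_directional.
- by move=> y; rewrite (le_trans (directional_le_self _ qs _)).
move=> l1 l2 s t ll1 ll2 s0 t0 st l1p l2p l12.
have [l1q l2q] : (forall x, l1 x <= s * q x) /\ (forall x, l2 x <= t * q x).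
  apply: qf => // y; exact: le_trans (l12 y) (directional_le_self _ qs _).
have := l12 (- x); rewrite (real_linearN x ll1) (real_linearN x ll2) => h.
have h2 := directional_oppr x qs.
have e1 : l1 x = s * q x.
  have : t * q x = q x - s * q x by rewrite -[X in X - _]mul1r -st; ring.
  by have := l1q x; have := l2q x; lra.
have e2 : l2 x = t * q x.
  have : t * q x = q x - s * q x by rewrite -[X in X - _]mul1r -st; ring.
  by have := l1q x; have := l2q x; lra.
have main l u : 0 <= u -> real_linear l -> (forall x, l x <= u * q x) ->
    l x = u * q x -> forall y, l y <= u * directional q x y.
  move=> u0 ll lq e y; have [u00|un0] := eqVneq u 0.
    by have := lq y; rewrite u00 !mul0r.
  have u_gt0 : 0 < u by lra.
  rewrite -ler_pdivrMl//; apply: le_directional => // c c0.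
  rewrite ler_pdivrMl//; have := lq (y + c%:C *: x).
  by rewrite ll.1 ll.2 e mulrBr; lra.
by split; exact: main.
Qed.

(** Lower bounds of chains, for Zorn. The pointwise infimum is finite since members are at least
    [- p (- x)] at [x], and subadditive since of two members the smaller one serves both
    arguments. *)
Lemma face_inf p (A : set (V -> R)) : sublinear p -> A !=set0 ->
  (forall q, A q -> face p q) ->
  (forall q q', A q -> A q' -> (forall x, q x <= q' x) \/ (forall x, q' x <= q x)) ->
  exists2 q0, face p q0 & forall q, A q -> forall x, q0 x <= q x.
Proof.
move=> ps [qA AqA] Af Atot.
pose q0 x := inf [set q x | q in A].
have Als q : A q -> sublinear q by move=> /Af[].
have lb x : lbound [set q x | q in A] (- p (- x)).
  move=> _ [q /[dup] Aq /Af[qs qp _] <-].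
  by rewrite (le_trans _ (sublinearN _ qs))// lerN2.
have q0le q x : A q -> q0 x <= q x.
  move=> Aq; apply: ge_inf; first by exists (- p (- x)).
  by exists q.
have leq0 x c : (forall q, A q -> c <= q x) -> c <= q0 x.
  by move=> h; apply: lb_le_inf; [exists (qA x), qA|move=> _ [q Aq <-]; exact: h].
exists q0; last by move=> q Aq x; exact: q0le.
split.
- split=> [x y|t x t0].
    rewrite -lerBlDr; apply: (leq0) => q Aq.
    rewrite lerBlDr -lerBlDl; apply: (leq0) => q' Aq'.
    rewrite lerBlDl; have [h|h] := Atot _ _ Aq Aq'.
    + rewrite (le_trans (q0le _ _ Aq))// (le_trans ((Als _ Aq).1 _ _))//.
      by rewrite lerD2l.
    + rewrite (le_trans (q0le _ _ Aq'))// (le_trans ((Als _ Aq').1 _ _))//.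
      by rewrite lerD2r.
  have [->|tn0] := eqVneq t 0.
    rewrite rmorph0 scale0r mul0r (le_trans (q0le _ _ AqA))// sublinear0//.
    exact: Als.
  have t_gt0 : 0 < t by lra.
  rewrite -ler_pdivrMl//; apply: (leq0) => q Aq; rewrite ler_pdivrMl//.
  by rewrite (le_trans (q0le _ _ Aq))//; exact: (Als _ Aq).2.
- move=> x; rewrite (le_trans (q0le _ _ AqA))//.
  by have [_ ] := Af _ AqA.
move=> l1 l2 s t ll1 ll2 s0 t0 st l1p l2p l12.
have key q : A q ->
    (forall x, l1 x <= s * q x) /\ (forall x, l2 x <= t * q x).
  move=> Aq; have [_ _ h] := Af _ Aq; apply: h => // x.
  exact: le_trans (l12 x) (q0le _ _ Aq).
have main l u : 0 <= u -> (forall q, A q -> forall x, l x <= u * q x) ->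
    forall y, l y <= u * q0 y.
  move=> u0 lq y; have [u00|un0] := eqVneq u 0.
    by have := lq _ AqA y; rewrite u00 !mul0r.
  have u_gt0 : 0 < u by lra.
  rewrite -ler_pdivrMl//; apply: (leq0) => q Aq.
  by rewrite ler_pdivrMl//; exact: lq.
by split; apply: main => // q /key[].
Qed.

Lemma sublinear_odd_real_linear q :
  sublinear q -> (forall x, q (- x) = - q x) -> real_linear q.
Proof.
move=> qs qN.
have qD x y : q (x + y) = q x + q y.
  apply/eqP; rewrite eq_le qs.1 /=.
  by have := qs.1 (x + y) (- y); rewrite addrK qN; lra.
have qZ (t : R) x : 0 <= t -> q (t%:C *: x) = t * q x.
  move=> t0; apply/eqP; rewrite eq_le qs.2//=.
  by have := qs.2 t (- x) t0; rewrite scalerN !qN; lra.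
split=> // t x; have [t0|t0] := leP 0 t; first exact: qZ.
have := qZ (- t) x; rewrite oppr_ge0 => /(_ (ltW t0)).
by rewrite raddfN/= scaleNr qN; lra.
Qed.

(* By Zorn there is a minimal sublinear functional among those cutting out a
   face; taking directional values shows that it is linear. *)
Lemma extreme_functional p x0 : sublinear p ->
  exists l, [/\ real_linear l, forall x, l x <= p x, l x0 = p x0 &
    forall l1 l2 (s t : R), real_linear l1 -> real_linear l2 ->
      0 <= s -> 0 <= t -> s + t = 1 ->
      (forall x, l1 x <= s * p x) -> (forall x, l2 x <= t * p x) ->
      (forall x, l1 x + l2 x = l x) -> forall x, l1 x = s * l x].
Proof.
move=> ps.
(* Working below [p0] instead of [p] forces [l x0 = p x0]. *)
pose p0 := directional p x0.
have fp0 : face p p0 by apply: face_directional; exact: face_refl.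
pose T := {q | face p q /\ forall x, q x <= p0 x}.
have t0 : T by exists p0.
(* The order is reversed: a maximal element is a minimal functional. *)
pose r (a b : T) := `[< forall x, sval b x <= sval a x >].
have [||A Atot|[l [fl lp0]] lmax] := @ZL_preorder T t0 r.
- by move=> t; apply/asboolP.
- move=> a b c /asboolP ba /asboolP cb; apply/asboolP => x.
  exact: le_trans (cb x) (ba x).
- have [[a Aa]|nA] := pselect (exists a, A a); last first.
    by exists t0 => s As; exfalso; apply: nA; exists s.
  have [|||q fq qle] := @face_inf p [set sval a | a in A] ps.
  + by exists (sval a), a.
  + by move=> _ [[q [fq ?]] _ <-].
  + move=> _ _ [b Ab <-] [c Ac <-].
    by have [/asboolP h|/asboolP h] := Atot _ _ Ab Ac; [right|left].
  have qT : face p q /\ forall x, q x <= p0 x.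
    split=> // x; apply: (le_trans (qle (sval a) _ x)); first by exists a.
    by case: (svalP a).
  exists (exist _ q qT) => s As; apply/asboolP => x /=.
  by apply: (qle); exists s.
have [ls lp lface] := fl.
(* [directional l x] is again admissible, so by minimality [l] lies below it, and its value at [- x]
   is at most [- l x]. *)
have lN x : l (- x) = - l x.
  apply/eqP; rewrite eq_le; apply/andP; split; last first.
    by have := sublinearN x ls; lra.
  have dT : face p (directional l x) /\ forall y, directional l x y <= p0 y.
    split; first exact: face_directional.
    by move=> y; rewrite (le_trans (directional_le_self _ ls _)).
  have := lmax (exist _ _ dT) => /(_ _)/asboolP /=.
  move=> h; apply: le_trans (directional_oppr _ ls).
  by apply: h; apply/asboolP => y /=; exact: directional_le_self.
have ll := sublinear_odd_real_linear ls lN.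
exists l; split => //.
  apply/eqP; rewrite eq_le lp /=.
  have := directional_oppr x0 ps; have := lp0 (- x0); rewrite lN /p0; lra.
move=> l1 l2 s t ll1 ll2 s0 t1 st l1p l2p l12 x.
have [l1l l2l] : (forall x, l1 x <= s * l x) /\ (forall x, l2 x <= t * l x).
  by apply: lface => // y; rewrite l12.
(* The reverse inequality is the same one at [- x], as [l1] and [l] are odd. *)
apply/eqP; rewrite eq_le l1l /=.
have := l1l (- x); rewrite real_linearN// lN; lra.
Qed.

End sublinear.

(** * Real-valued norm and dual space *)

Section rnorm_theory.
Context {R : realType} {V : normedModType R[i]}.
Implicit Types x y : V.

Lemma rnormE x : `|x| = (rnorm x)%:C.
Proof. by rewrite /rnorm RRe_real// normr_real. Qed.

Lemma rnorm_ge0 x : 0 <= rnorm x.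
Proof. by rewrite -ler0c -rnormE. Qed.

Lemma rnorm_le_normr x (c : R) : (rnorm x <= c) = (`|x| <= c%:C).
Proof. by rewrite rnormE lecR. Qed.

Lemma rnormD x y : rnorm (x + y) <= rnorm x + rnorm y.
Proof. by rewrite -lecR rmorphD/= -!rnormE ler_normD. Qed.

Lemma rnormN x : rnorm (- x) = rnorm x.
Proof. by rewrite /rnorm normrN. Qed.

Lemma rnormB x y : rnorm (x - y) <= rnorm x + rnorm y.
Proof. by rewrite (le_trans (rnormD _ _))// rnormN. Qed.

Lemma rnorm0 : rnorm (0 : V) = 0.
Proof. by rewrite /rnorm normr0. Qed.

Lemma rnorm_eq0 x : (rnorm x == 0) = (x == 0).
Proof.
by rewrite -[x == 0]normr_eq0 rnormE; apply/eqP/eqP => [->|/complexI].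
Qed.

Lemma rnormZ (a : R[i]^o) x : rnorm (a *: x) = rnorm a * rnorm x.
Proof. by apply: complexI; rewrite rmorphM/= -!rnormE normrZ. Qed.

Lemma rnormZr (t : R) x : rnorm (t%:C *: x) = `|t| * rnorm x.
Proof.
apply: complexI; rewrite rmorphM/= -!rnormE normrZ; congr (_ * _).
by rewrite normc_def/= expr0n addr0 sqrtr_sqr.
Qed.

End rnorm_theory.

Section complex_norm.
Context {R : realType}.
Implicit Types a b : R[i]^o.

Lemma rnormM a b : rnorm (a * b : R[i]^o) = rnorm a * rnorm b.
Proof. exact: (rnormZ a b). Qed.

Lemma rnormC (t : R) : rnorm (t%:C : R[i]^o) = `|t|.
Proof. by rewrite /rnorm normc_def/= expr0n addr0 sqrtr_sqr. Qed.

Lemma rnorm_def a : rnorm a = Num.sqrt (complex.Re a ^+ 2 + complex.Im a ^+ 2).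
Proof. by rewrite /rnorm normc_def. Qed.

Lemma rnorm_i : rnorm ('i : R[i]^o) = 1.
Proof. by rewrite rnorm_def /= expr0n add0r expr1n sqrtr1. Qed.

Lemma normRe_le_rnorm a : `|complex.Re a| <= rnorm a.
Proof. by rewrite -lecR -rnormE normc_ge_Re. Qed.

Lemma Re_le_rnorm a : complex.Re a <= rnorm a.
Proof. exact: le_trans (ler_norm _) (normRe_le_rnorm a). Qed.

Lemma rnorm1P a : (`|a| = 1) <-> (rnorm a = 1).
Proof. by rewrite rnormE; split=> [/complexI|->]. Qed.

Lemma phase a : exists2 u : R[i]^o, rnorm u = 1 & u * a = (rnorm a)%:C.
Proof.
have [->|a0] := eqVneq a 0.
  by exists 1; [apply/rnorm1P; rewrite normr1|rewrite mulr0 rnorm0].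
exists (a^-1 * `|a|).
  by apply/rnorm1P; rewrite normrM normr_id normfV mulVf// normr_eq0.
by rewrite mulrAC mulVf// mul1r rnormE.
Qed.

End complex_norm.

Section dual.
Context {R : realType} {F : normedModType R[i]}.
Implicit Types (phi : F -> R[i]^o) (x : F).

(** Multiplying [x] by a phase makes [phi x] real and nonnegative without changing the norm of
    [x]. *)
Lemma linear_bound_Re phi (M : R) : linear phi ->
  (forall x, complex.Re (phi x) <= M * rnorm x) ->
  forall x, rnorm (phi x) <= M * rnorm x.
Proof.
move=> lphi h x; have [u u1 ux] := phase (phi x).
have := h (u *: x); rewrite rnormZ u1 mul1r.
have -> : phi (u *: x) = u * phi x.
  have phi0 : phi 0 = 0 by have := lphi (-1) 0 0; rewrite scaler0 addr0 scaleN1r addNr.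
  by have := lphi u x 0; rewrite phi0 !addr0.
by rewrite ux.
Qed.

Lemma linear_bound_continuous phi (M : R) : linear phi ->
  (forall x, rnorm (phi x) <= M * rnorm x) -> continuous phi.
Proof.
move=> lphi h.
pose L : {linear F -> R[i]^o} :=
  HB.pack phi (GRing.isLinear.Build _ _ _ _ phi lphi).
apply: (@bounded_linear_continuous _ _ _ L).
apply/linear_boundedP; exists M%:C; split.
  by apply/complex_realP; exists M.
move=> r Mr x; have := h x; rewrite -lecR rmorphM/= -!rnormE => /le_trans; apply.
by rewrite ler_wpM2r// ltW.
Qed.

Lemma topdual_bounded phi : topdual phi ->
  exists2 M : R, 0 <= M & forall x, rnorm (phi x) <= M * rnorm x.
Proof.
move=> [lphi cphi].
pose L : {linear F -> R[i]^o} :=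
  HB.pack phi (GRing.isLinear.Build _ _ _ _ phi lphi).
have /linear_bounded_continuous/linear_boundedP := cphi : continuous L.
move=> /pinfty_ex_gt0[M M0 h].
have MC : M = (complex.Re M)%:C by rewrite RRe_real// gtr0_real.
exists (complex.Re M); first by rewrite -ler0c -MC ltW.
by move=> x; rewrite -lecR rmorphM/= -!rnormE -MC; exact: h.
Qed.

Lemma opnorm_has_sup phi : topdual phi ->
  has_sup [set rnorm (phi x) | x in [set x : F | `|x| <= 1]].
Proof.
move=> /topdual_bounded[M M0 h]; split.
  by exists (rnorm (phi 0)), 0 => //=; rewrite normr0.
exists M => _ [x /= x1 <-]; rewrite (le_trans (h x))// ler_piMr//.
by rewrite rnorm_le_normr.
Qed.

Lemma topdual_linear0 phi : topdual phi -> phi 0 = 0.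
Proof. by case=> h _; have := h (-1) 0 0; rewrite scaler0 addr0 scaleN1r addNr. Qed.

Lemma topdualZ phi a x : topdual phi -> phi (a *: x) = a * phi x.
Proof.
by move=> /[dup] /topdual_linear0 h0 [h _]; have := h a x 0; rewrite h0 !addr0.
Qed.

Lemma topdualD phi x y : topdual phi -> phi (x + y) = phi x + phi y.
Proof. by case=> h _; have := h 1 x y; rewrite !scale1r. Qed.

Lemma topdualN phi x : topdual phi -> phi (- x) = - phi x.
Proof. by move=> h; rewrite -scaleN1r topdualZ// mulN1r. Qed.

Lemma topdualB phi x y : topdual phi -> phi (x - y) = phi x - phi y.
Proof. by move=> h; rewrite topdualD// topdualN. Qed.

Lemma le_opnorm1 phi x : topdual phi -> rnorm x <= 1 -> rnorm (phi x) <= opnorm phi.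
Proof.
move=> /opnorm_has_sup h x1; apply: sup_upper_bound => //.
by exists x => //=; rewrite -rnorm_le_normr.
Qed.

Lemma opnorm_ge0 phi : topdual phi -> 0 <= opnorm phi.
Proof.
by move=> h; rewrite (le_trans (rnorm_ge0 (phi 0)))// le_opnorm1// rnorm0.
Qed.

Lemma le_opnorm phi x : topdual phi -> rnorm (phi x) <= opnorm phi * rnorm x.
Proof.
move=> h; have [->|x0] := eqVneq x 0.
  by rewrite topdual_linear0// !rnorm0 mulr0.
have nx : 0 < rnorm x by rewrite lt_neqAle eq_sym rnorm_eq0 x0 rnorm_ge0.
have := @le_opnorm1 phi ((rnorm x)^-1%:C *: x) h.
rewrite topdualZ// rnormM rnormC rnormZr gtr0_norm ?invr_gt0// mulVf ?gt_eqF//.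
by move=> /(_ (lexx _)); rewrite ler_pdivrMl// mulrC.
Qed.

Lemma opnorm_le phi (M : R) :
  (forall x, rnorm x <= 1 -> rnorm (phi x) <= M) -> opnorm phi <= M.
Proof.
move=> h; apply: sup_le_ub.
  by exists (rnorm (phi 0)), 0 => //=; rewrite normr0.
by move=> _ [x /= x1 <-]; apply: h; rewrite rnorm_le_normr.
Qed.

Lemma topdual_Re_real_linear phi : topdual phi ->
  real_linear (fun x => complex.Re (phi x)).
Proof.
move=> h; split=> [x y|t x]; first by rewrite topdualD//; case: (phi x) (phi y) => [? ?] [].
by rewrite topdualZ//; case: (phi x) => a b; simpc.
Qed.

Lemma topdual_eqRe phi psi : topdual phi -> topdual psi ->
  (forall x, complex.Re (phi x) = complex.Re (psi x)) -> phi = psi.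
Proof.
move=> h1 h2 e; apply/funext => x.
have := e ('i *: x); rewrite !topdualZ//; have := e x.
by case: (phi x) (psi x) => [a b] [c d] /=; simpc => -> /oppr_inj ->.
Qed.

Lemma topdual_lin (a : R[i]) phi psi : topdual phi -> topdual psi ->
  topdual (a *: phi + psi).
Proof.
move=> h1 h2; have lin : linear (a *: phi + psi).
  move=> b x y.
  rewrite -![(_ + psi) _]/(a * phi _ + psi _) !topdualD// !topdualZ//.
  rewrite -[b *: (_ + _)]/(b * (_ + _)).
  rewrite mulrDr !mulrA [a * b]mulrC mulrDr !mulrA; ring.
have [M1 M10 hM1] := topdual_bounded h1; have [M2 M20 hM2] := topdual_bounded h2.
split=> //; apply: (linear_bound_continuous (M := rnorm (a : R[i]^o) * M1 + M2)) => // x.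
rewrite -[(_ + psi) _]/(a * phi _ + psi _) (le_trans (rnormD _ _))// rnormM.
by rewrite mulrDl lerD// -mulrA ler_wpM2l ?rnorm_ge0.
Qed.

End dual.

Section complexification.
Context {R : realType} {V : lmodType R[i]}.

(** For real-linear [l], the complex-linear functional with real part [l]. *)
Definition complexify (l : V -> R) (x : V) : R[i]^o :=
  l x +i* (- l ('i *: x)).

Lemma complexify_linear l : real_linear l -> linear (complexify l).
Proof.
move=> ll a x y; rewrite /complexify.
have lZ (b : R[i]) z : l (b *: z) = complex.Re b * l z + complex.Im b * l ('i *: z).
  by rewrite {1}(complexE b) ['i * _]mulrC scalerDl -scalerA ll.1 ll.2 ll.2.
rewrite scalerDr !ll.1 scalerA (lZ a) (lZ ('i * a)%R).
case: a => a b /=; rewrite !(mul0r, mul1r, sub0r, add0r, addr0); congr (_ +i* _); rewrite /=; ring.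
Qed.

End complexification.

(** * Zero-one measures and complex L1 spaces *)

Section zero_one.
Context d (T : measurableType d) (R : realType).
Variables (mu : {measure set T -> \bar R}) (A : set T).
Hypothesis A01 : forall B : set T, measurable B ->
  (\forall t \ae mu, A t -> ~ B t) \/ (\forall t \ae mu, A t -> B t).
Hypothesis A_pos : ~ \forall t \ae mu, ~ A t.

(** The constant is the supremum of the levels [s] with [u > s w] almost everywhere on [A]; a level
    without this property satisfies [u <= s w] almost everywhere on [A], by the zero-one
    hypothesis. *)
Lemma zero_one_ratio (u w : T -> R) :
  measurable_fun setT u -> measurable_fun setT w ->
  (forall t, A t -> 0 < w t) ->
  exists c : R, \forall t \ae mu, A t -> u t = c * w t.
Proof.
move=> m_u mw w_gt0.
pose P (s : R) := \forall t \ae mu, A t -> ~ (u t <= s * w t).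
have P01 s : ~ P s -> \forall t \ae mu, A t -> u t <= s * w t.
  move=> nP; have [|//|//] := A01 (B := [set t | u t <= s * w t]).
  rewrite -[X in measurable X]setTI; apply: measurable_fun_le => //.
  exact: measurable_funM.
have Pmono s s' : s' <= s -> P s -> P s'.
  move=> ss' Ps; apply: filterS Ps => t ht At us; apply: (ht At).
  by rewrite (le_trans us)// ler_wpM2r// ltW// w_gt0.
pose S := [set s | P s].
(* Otherwise [u <= - n w] almost everywhere on [A] for all [n] at once, which no point of [A]
   satisfies. *)
have S0 : S !=set0.
  apply: contrapT => nS; apply: A_pos.
  have h (n : nat) : \forall t \ae mu, A t -> u t <= - n%:R * w t.
    by apply: P01 => Pn; apply: nS; exists (- n%:R).
  have := ae_foralln h; apply: filterS => t ht At.
  have wt := w_gt0 _ At.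
  have := archi_boundP (normr_ge0 (u t / w t)).
  set n := Num.bound _ => hn; have := ht n At.
  rewrite -ler_pdivrMr//; have := ler_norm (- (u t / w t)); rewrite normrN; lra.
have Sub : has_ubound S.
  apply: contrapT => nS; apply: A_pos.
  have h (n : nat) : P n%:R.
    apply: contrapT => nP; apply: nS; exists n%:R => s Ps.
    rewrite leNgt; apply/negP => sn; apply: nP; exact: Pmono (ltW sn) Ps.
  have := ae_foralln h; apply: filterS => t ht At.
  have wt := w_gt0 _ At.
  have := archi_boundP (normr_ge0 (u t / w t)).
  set n := Num.bound _ => hn; apply: (ht n At).
  by rewrite -ler_pdivrMr// ltW// (le_lt_trans (ler_norm _)).
pose c := sup S; exists c.
(* Only countably many levels around [c] are used, so the exceptional null sets have a null
   union. *)
have hlo (n : nat) : P (c - n.+1%:R^-1).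
  have [s Ss cs] : exists2 s, S s & c - n.+1%:R^-1 < s.
    by apply: sup_adherent; [rewrite invr_gt0|split].
  exact: Pmono (ltW cs) Ss.
have hhi (n : nat) : \forall t \ae mu, A t -> u t <= (c + n.+1%:R^-1) * w t.
  apply: P01 => Ps.
  have : c + n.+1%:R^-1 <= c by apply: sup_upper_bound.
  by rewrite leNgt ltrDl invr_gt0 ltr0n.
apply: filterS2 (ae_foralln hlo) (ae_foralln hhi) => t lo hi At; have wt := w_gt0 _ At.
have {}lo n := lo n At; have {}hi n := hi n At.
suff : u t / w t = c by move=> <-; rewrite divfK// gt_eqF.
apply/eqP; rewrite eq_le; apply/andP; split; apply/ler_addgt0Pr => e e0.
  have hn : e^-1 < (Num.bound e^-1)%:R by apply: archi_boundP; rewrite invr_ge0 ltW.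
  have := hi (Num.bound e^-1); rewrite -ler_pdivrMr// => /le_trans; apply.
  rewrite lerD2l invf_ple ?posrE//; apply: ltW (lt_le_trans hn _).
  by rewrite ler_nat.
have hn : e^-1 < (Num.bound e^-1)%:R by apply: archi_boundP; rewrite invr_ge0 ltW.
have /negP := lo (Num.bound e^-1); rewrite -ltNge -ltr_pdivlMr// => /ltW.
rewrite lerBlDr => /le_trans; apply.
rewrite lerD2l invf_ple ?posrE//; apply: ltW (lt_le_trans hn _).
by rewrite ler_nat.
Qed.

End zero_one.

Section L1.
Context d (T : measurableType d) (R : realType).
Variable mu : {measure set T -> \bar R}.
Implicit Types g h : T -> R[i]^o.

Definition cmeasurable g : Prop :=
  measurable_fun setT (fun t => complex.Re (g t)) /\
  measurable_fun setT (fun t => complex.Im (g t)).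

Lemma cL1_cmeasurable g : cL1 mu g -> cmeasurable g.
Proof. by case. Qed.

Lemma cmeasurable_rnorm g : cmeasurable g -> measurable_fun setT (fun t => rnorm (g t)).
Proof.
move=> [mr mi]; under eq_fun do rewrite rnorm_def.
have ms : measurable_fun setT (@Num.sqrt R).
  by apply: continuous_measurable_fun; exact: sqrt_continuous.
by apply: (measurableT_comp ms); apply: measurable_funD; apply: measurable_funX.
Qed.

Lemma cmeasurable_rnorm_EFin g : cmeasurable g ->
  measurable_fun setT (fun t => (rnorm (g t))%:E).
Proof. by move=> /cmeasurable_rnorm/measurable_EFinP. Qed.

Lemma cmeasurable_lin (a : R[i]) g h : cmeasurable g -> cmeasurable h ->
  cmeasurable (a *: g + h).
Proof.
case: a => a b [gr gi] [hr hi]; split.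
  rewrite (_ : (fun _ => _) = fun t => a * complex.Re (g t) - b * complex.Im (g t) + complex.Re (h t)).
    by apply: measurable_funD => //; apply: measurable_funB; apply: measurable_funM.
  apply/funext => t; rewrite -[((a +i* b) *: g + h) t]/((a +i* b) * g t + h t).
  by case: (g t) (h t) => [? ?] [? ?].
rewrite (_ : (fun _ => _) = fun t => a * complex.Im (g t) + b * complex.Re (g t) + complex.Im (h t)).
  by apply: measurable_funD => //; apply: measurable_funD; apply: measurable_funM.
apply/funext => t; rewrite -[((a +i* b) *: g + h) t]/((a +i* b) * g t + h t).
by case: (g t) (h t) => [? ?] [? ?].
Qed.

Lemma L1norm_ge0 g : (0 <= L1norm mu g)%E.
Proof. by apply: integral_ge0 => t _; rewrite lee_fin rnorm_ge0. Qed.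

Lemma L1normZ (a : R[i]^o) g : cmeasurable g ->
  L1norm mu (a *: g) = ((rnorm a)%:E * L1norm mu g)%E.
Proof.
move=> mg; rewrite /L1norm; under eq_integral do rewrite rnormZ EFinM.
rewrite ge0_integralZl_EFin ?rnorm_ge0//.
- by move=> t _; rewrite lee_fin rnorm_ge0.
- exact: cmeasurable_rnorm_EFin.
Qed.

Lemma L1norm_eq0 g : cmeasurable g ->
  L1norm mu g = 0%E <-> \forall t \ae mu, g t = 0.
Proof.
move=> mg; rewrite /L1norm.
have -> : (\int[mu]_t (rnorm (g t))%:E = \int[mu]_t `|(rnorm (g t))%:E|)%E.
  by apply: eq_integral => t _; rewrite gee0_abs// lee_fin rnorm_ge0.
rewrite ae_eq_integral_abs//; last exact: cmeasurable_rnorm_EFin.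
split; apply: filterS => t.
  by move=> /(_ I) [] /eqP; rewrite rnorm_eq0 => /eqP.
by move=> -> _; rewrite rnorm0.
Qed.

(** The source of both l1-decompositions below: cutting along a set, and splitting off a multiple of
    [g] on its support. *)
Lemma L1norm_ae_add g h k : cmeasurable g -> cmeasurable h -> cmeasurable k ->
  (\forall t \ae mu, rnorm (g t) + rnorm (h t) = rnorm (k t)) ->
  (L1norm mu g + L1norm mu h = L1norm mu k)%E.
Proof.
move=> mg mh mk e; rewrite /L1norm -ge0_integralD//; last 4 first.
- by move=> t _; rewrite lee_fin rnorm_ge0.
- exact: cmeasurable_rnorm_EFin.
- by move=> t _; rewrite lee_fin rnorm_ge0.
- exact: cmeasurable_rnorm_EFin.
apply: ge0_ae_eq_integral => //.
- by apply: emeasurable_funD; exact: cmeasurable_rnorm_EFin.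
- exact: cmeasurable_rnorm_EFin.
- by move=> t _; rewrite adde_ge0// lee_fin rnorm_ge0.
- by move=> t _; rewrite lee_fin rnorm_ge0.
- by apply: filterS e => t e _; rewrite -e EFinD.
Qed.

Lemma cL1_lin (a : R[i]) g h : cL1 mu g -> cL1 mu h -> cL1 mu (a *: g + h).
Proof.
move=> /[dup] /cL1_cmeasurable mg [_ _ fg] /[dup] /cL1_cmeasurable mh [_ _ fh].
have mgh := cmeasurable_lin a mg mh.
split; [by case: mgh|by case: mgh|].
have mag : cmeasurable (a *: g).
  have -> : a *: g = a *: g + a *: (0 : T -> R[i]^o) by rewrite scaler0 addr0.
  have m0 : cmeasurable (0 : T -> R[i]^o) by split; exact: measurable_cst.
  by rewrite scaler0; exact: cmeasurable_lin.
apply: (@le_lt_trans _ _ (L1norm mu (a *: g) + L1norm mu h)%E).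
  rewrite /L1norm -ge0_integralD//; last 4 first.
  - by move=> t _; rewrite lee_fin rnorm_ge0.
  - exact: cmeasurable_rnorm_EFin.
  - by move=> t _; rewrite lee_fin rnorm_ge0.
  - exact: cmeasurable_rnorm_EFin.
  apply: ge0_le_integral => //.
  - by move=> t _; rewrite lee_fin rnorm_ge0.
  - exact: cmeasurable_rnorm_EFin.
  - by apply: emeasurable_funD; exact: cmeasurable_rnorm_EFin.
  - by move=> t _; rewrite -EFinD lee_fin rnormD.
by rewrite lte_add_pinfty// L1normZ// lte_mul_pinfty// lee_fin rnorm_ge0.
Qed.

Definition cutoff (B : set T) g : T -> R[i]^o := fun t => (\1_B t)%:C * g t.

Lemma cmeasurable_cutoff B g : measurable B -> cmeasurable g ->
  cmeasurable (cutoff B g).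
Proof.
move=> mB [mr mi]; split.
  rewrite (_ : (fun _ => _) = fun t => \1_B t * complex.Re (g t)).
    by apply: measurable_funM => //; exact: measurable_indic.
  by apply/funext => t; rewrite /cutoff; case: (g t) => a b; simpc.
rewrite (_ : (fun _ => _) = fun t => \1_B t * complex.Im (g t)).
  by apply: measurable_funM => //; exact: measurable_indic.
by apply/funext => t; rewrite /cutoff; case: (g t) => a b; simpc.
Qed.

Lemma L1norm_cutoff B g : measurable B -> cmeasurable g ->
  (L1norm mu (cutoff B g) + L1norm mu (cutoff (~` B) g) = L1norm mu g)%E.
Proof.
move=> mB mg; apply: L1norm_ae_add => //; try exact: cmeasurable_cutoff.
  by apply: cmeasurable_cutoff => //; exact: measurableC.
apply: nearW => t; rewrite /cutoff !rnormM !rnormC !indicE in_setC.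
by case: (t \in B); rewrite normr1 normr0 mul0r mul1r ?addr0 ?add0r.
Qed.

Lemma cL1_cutoff B g : measurable B -> cL1 mu g -> cL1 mu (cutoff B g).
Proof.
move=> mB /[dup] /cL1_cmeasurable mg [_ _ fg].
have mBg := cmeasurable_cutoff mB mg.
split; [by case: mBg|by case: mBg|].
by rewrite (le_lt_trans _ fg)// -(L1norm_cutoff mB mg) leeDl// L1norm_ge0.
Qed.

Lemma cutoffD B g : cutoff B g + cutoff (~` B) g = g.
Proof.
apply/funext => t; rewrite /cutoff fctE !indicE in_setC.
by case: (t \in B); rewrite /= mul1r mul0r ?addr0 ?add0r.
Qed.

End L1.

(** * Extreme functionals on a Lindenstrauss space *)

(* [e] is the second-dual coordinate along [phi]: the dual is the l1-direct sum
   of the line spanned by [phi] and of the kernel of [e]. *)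
Definition L_summand (R : realType) (F : normedModType R[i])
    (phi : F -> R[i]^o) (e : (F -> R[i]^o) -> R[i]^o) : Prop :=
  [/\ topdual phi, opnorm phi = 1,
      forall (a : R[i]) psi1 psi2, topdual psi1 -> topdual psi2 ->
        e (a *: psi1 + psi2) = a * e psi1 + e psi2,
      e phi = 1 &
      forall psi, topdual psi ->
        rnorm (e psi) + opnorm (psi - e psi *: phi) <= opnorm psi].

Section norming.
Context {R : realType} {F : normedModType R[i]}.

Lemma sublinear_rnorm : sublinear (@rnorm R F).
Proof.
by split=> [x y|t x t0]; [exact: rnormD|rewrite rnormZr ger0_norm].
Qed.

Lemma complexify_topdual (l : F -> R) : real_linear l ->
  (forall x, l x <= rnorm x) ->
  topdual (complexify l) /\ forall x, rnorm (complexify l x) <= rnorm x.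
Proof.
move=> ll lp; have lin := complexify_linear ll.
have h x : rnorm (complexify l x) <= 1 * rnorm x.
  by apply: linear_bound_Re => // y; rewrite mul1r; exact: lp.
split; last by move=> x; rewrite -[leRHS]mul1r.
by split => //; exact: linear_bound_continuous h.
Qed.

Lemma rnorm_le_Re (a : R[i]^o) : rnorm a <= complex.Re a -> a = (rnorm a)%:C.
Proof.
move=> h; have e : complex.Re a = rnorm a.
  by apply/eqP; rewrite eq_le h Re_le_rnorm.
have h2 : rnorm a ^+ 2 = complex.Re a ^+ 2 + complex.Im a ^+ 2.
  by rewrite rnorm_def sqr_sqrtr// addr_ge0// sqr_ge0.
have : complex.Im a ^+ 2 = 0 by move: h2; rewrite e; lra.
move=> /eqP; rewrite sqrf_eq0 => /eqP i0.
by apply/eqP; rewrite eq_complex /= e i0 !eqxx.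
Qed.

Lemma opnorm0 : opnorm (0 : F -> R[i]^o) = 0.
Proof.
apply/eqP; rewrite eq_le; apply/andP; split.
  by apply: opnorm_le => x _; rewrite rnorm0.
apply: opnorm_ge0; split; last exact: cst_continuous.
by move=> a x y; rewrite scaler0 addr0.
Qed.

End norming.

(** * Extreme points of the dual ball as atoms of L_1(mu) *)

Section lindenstrauss_summand.
Context {R : realType} {F : normedModType R[i]}.
Context d (T : measurableType d) (mu : {measure set T -> \bar R}).
Variable Phi : (T -> R[i]^o) -> (F -> R[i]^o).
Hypothesis Phi_topdual : forall g, cL1 mu g -> topdual (Phi g).
Hypothesis Phi_lin : forall (a : R[i]) g h, cL1 mu g -> cL1 mu h ->
  Phi (a *: g + h) = a *: Phi g + Phi h.
Hypothesis Phi_norm : forall g, cL1 mu g -> (opnorm (Phi g))%:E = L1norm mu g.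
Hypothesis Phi_surj : forall phi, topdual phi -> exists2 g, cL1 mu g & Phi g = phi.

Variables (l : F -> R) (g : T -> R[i]^o).
Let phi := complexify l.
(** Extremality of [l] in the real dual ball, with the weights [s] and [t] of a convex combination
    absorbed into the two summands. *)
Hypothesis l_extreme : forall l1 l2 (s t : R), real_linear l1 -> real_linear l2 ->
  0 <= s -> 0 <= t -> s + t = 1 ->
  (forall x, l1 x <= s * rnorm x) -> (forall x, l2 x <= t * rnorm x) ->
  (forall x, l1 x + l2 x = l x) -> forall x, l1 x = s * l x.
Hypothesis phi_topdual : topdual phi.
Hypothesis phi_norm : opnorm phi = 1.
Hypothesis gL : cL1 mu g.
Hypothesis Phi_g : Phi g = phi.

Let L1norm_g : L1norm mu g = 1%E.
Proof. by rewrite -Phi_norm// Phi_g phi_norm. Qed.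

Lemma extreme_not_ae0 : ~ \forall t \ae mu, ~ g t != 0.
Proof.
move=> g0; have /L1norm_eq0 h := cL1_cmeasurable gL.
have : L1norm mu g = 0%E by apply/h; apply: filterS g0 => t /negP; rewrite negbK => /eqP.
by rewrite L1norm_g => /eqP; rewrite eqe oner_eq0.
Qed.

(* Splitting [g] along [B] writes [phi] as a sum of two functionals whose norms
   add up to 1, so both are multiples of [phi] by extremality. *)
Lemma extreme_zero_one (B : set T) : measurable B ->
  (\forall t \ae mu, g t != 0 -> ~ B t) \/ (\forall t \ae mu, g t != 0 -> B t).
Proof.
move=> mB.
have g1L := cL1_cutoff mB gL; have g2L := cL1_cutoff (measurableC mB) gL.
set g1 := cutoff B g in g1L; set g2 := cutoff (~` B) g in g2L.
have t1 := Phi_topdual g1L; have t2 := Phi_topdual g2L.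
pose s := opnorm (Phi g1); pose t := opnorm (Phi g2).
have st : s + t = 1.
  have := L1norm_cutoff mu mB (cL1_cmeasurable gL).
  by rewrite -/g1 -/g2 -(Phi_norm g1L) -(Phi_norm g2L) L1norm_g -EFinD => -[].
have sum x : Phi g1 x + Phi g2 x = phi x.
  have := Phi_lin 1 g1L g2L; rewrite !scale1r cutoffD Phi_g => ->.
  by [].
have phi1 : Phi g1 = s%:C *: phi.
  have tsphi : topdual (s%:C *: phi).
    by have := topdual_lin (s%:C - 1) phi_topdual phi_topdual; rewrite scalerBl scale1r subrK.
  apply: (topdual_eqRe t1 tsphi) => x; transitivity (s * l x).
    have Re1 y : complex.Re (Phi g1 y) <= s * rnorm y.
      by rewrite (le_trans (Re_le_rnorm _))// le_opnorm.
    have Re2 y : complex.Re (Phi g2 y) <= t * rnorm y.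
      by rewrite (le_trans (Re_le_rnorm _))// le_opnorm.
    have Re12 y : complex.Re (Phi g1 y) + complex.Re (Phi g2 y) = l y.
      rewrite -[RHS]/(complex.Re (phi y)) -sum.
      by case: (Phi g1 y) (Phi g2 y) => [? ?] [].
    exact: (l_extreme (topdual_Re_real_linear t1) (topdual_Re_real_linear t2)
      (opnorm_ge0 t1) (opnorm_ge0 t2) st Re1 Re2 Re12 x).
  rewrite -[(s%:C *: phi) x]/(s%:C * phi x) -[l x]/(complex.Re (phi x)).
  by case: (phi x) => a b; rewrite /= mul0r subr0.
(* [Phi] preserves norms, so [(1_B - s) g] vanishes almost everywhere: where [g] is nonzero the
   indicator of [B] is the constant [s], and whether [s = 0] selects the alternative. *)
have kL := cL1_lin (- s%:C) gL g1L.
have k0 : \forall u \ae mu, (- s%:C *: g + g1) u = 0.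
  apply/(L1norm_eq0 mu (cL1_cmeasurable kL)).
  rewrite -Phi_norm// Phi_lin// Phi_g phi1 scaleNr addNr.
  by rewrite opnorm0.
have {}k0 : \forall u \ae mu, g u != 0 -> \1_B u = s.
  apply: filterS k0 => u; rewrite -[(_ + _) u]/(- s%:C * g u + (\1_B u)%:C * g u).
  rewrite -mulrDl => /eqP; rewrite mulf_eq0 => /orP[|/eqP->]; last by rewrite eqxx.
  by rewrite addrC subr_eq0 => /eqP/complexI h _.
have [s0|s0] := eqVneq s 0.
  left; apply: filterS k0 => u h /h; rewrite s0 indicE => /eqP.
  by case: (boolP (u \in B)); rewrite ?oner_eq0// notin_setE.
right; apply: filterS k0 => u h /h; rewrite indicE.
case: (boolP (u \in B)); first by rewrite inE.
by move=> _ /esym/eqP; rewrite (negbTE s0).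
Qed.

(** [c] is the coefficient of [psi] on the atom carrying [g]; the representative [h] is constrained
    only where [g] is nonzero. *)
Let coordinate (psi : F -> R[i]^o) (c : R[i]^o) : Prop :=
  exists h, [/\ cL1 mu h, Phi h = psi & \forall t \ae mu, g t != 0 -> h t = c * g t].

(** The quotient [h / g] is [h] times the conjugate of [g], over the squared modulus [w] of [g]; the
    zero-one property makes its real and imaginary parts constant. *)
Let coordinate_total psi : topdual psi -> exists c, coordinate psi c.
Proof.
move=> /Phi_surj[h hL hpsi].
have [mgr mgi] := cL1_cmeasurable gL; have [mhr mhi] := cL1_cmeasurable hL.
pose w t := complex.Re (g t) ^+ 2 + complex.Im (g t) ^+ 2.
have mw : measurable_fun setT w by apply: measurable_funD; apply: measurable_funX.
have w_gt0 t : g t != 0 -> 0 < w t.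
  rewrite /w; case: (g t) => a b /=; rewrite eq_complex /= negb_and => ab.
  rewrite lt_neqAle addr_ge0 ?sqr_ge0// andbT eq_sym paddr_eq0 ?sqr_ge0//.
  by rewrite !sqrf_eq0 negb_and.
have ratio := zero_one_ratio extreme_zero_one extreme_not_ae0 _ mw w_gt0.
have [|c1 hc1] := ratio (fun t => complex.Re (h t) * complex.Re (g t) +
                                  complex.Im (h t) * complex.Im (g t)).
  by apply: measurable_funD; apply: measurable_funM.
have [|c2 hc2] := ratio (fun t => complex.Im (h t) * complex.Re (g t) -
                                  complex.Re (h t) * complex.Im (g t)).
  by apply: measurable_funB; apply: measurable_funM.
exists (c1 +i* c2), h; split=> //.
apply: filterS2 hc1 hc2 => t + + gt0 => /(_ gt0) + /(_ gt0).
have := w_gt0 t gt0; rewrite /w.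
case: (g t) (h t) => [a b] [x y] /= wp e1 e2.
have wn0 : a ^+ 2 + b ^+ 2 != 0 by rewrite gt_eqF.
apply/eqP; rewrite eq_complex /=; apply/andP; split; apply/eqP; apply: (mulIf wn0).
  transitivity (a * (x * a + y * b) - b * (y * a - x * b)); first by ring.
  by rewrite e1 e2; ring.
transitivity (b * (x * a + y * b) + a * (y * a - x * b)); first by ring.
by rewrite e1 e2; ring.
Qed.

Let coordinate_lin (a : R[i]) (psi1 psi2 : F -> R[i]^o) c1 c2 :
  coordinate psi1 c1 -> coordinate psi2 c2 ->
  coordinate (a *: psi1 + psi2) (a * c1 + c2).
Proof.
move=> [h1 [h1L <- e1]] [h2 [h2L <- e2]]; exists (a *: h1 + h2); split.
- exact: cL1_lin.
- exact: Phi_lin.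
apply: filterS2 e1 e2 => t e1 e2 gt0.
by rewrite -[(_ + _) t]/(a * h1 t + h2 t) e1// e2//; ring.
Qed.

(** Almost everywhere, [c g] vanishes off the support of [g] and [h - c g] vanishes on it, so their
    norms add up to that of [h]. *)
Let coordinate_le psi c : coordinate psi c ->
  rnorm c + opnorm (psi - c *: phi) <= opnorm psi.
Proof.
move=> [h [hL <- hc]]; have kL := cL1_lin (- c) gL hL.
have mg := cL1_cmeasurable gL; have mh := cL1_cmeasurable hL.
have mcg : cmeasurable (c *: g).
  have := cmeasurable_lin (c - 1) mg mg; rewrite scalerBl scale1r subrK; exact.
have : (L1norm mu (c *: g)%R + L1norm mu (- c *: g + h)%R = L1norm mu h)%E.
  apply: (L1norm_ae_add mcg (cL1_cmeasurable kL) mh).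
  apply: filterS hc => t hc.
  rewrite -[(c *: g) t]/(c * g t) -[(_ + _) t]/(- c * g t + h t).
  have [->|/hc ->] := eqVneq (g t) 0; first by rewrite !mulr0 rnorm0 !add0r.
  by rewrite mulNr addNr rnorm0 addr0.
rewrite L1normZ// L1norm_g mule1 -!Phi_norm// Phi_lin// Phi_g => -[<-].
by rewrite [Phi h - _]addrC -scaleNr.
Qed.

Lemma extreme_L_summand : exists e, L_summand phi e.
Proof.
have /choice[e he] : forall psi, exists c, topdual psi -> coordinate psi c.
  move=> psi; have [h|h] := pselect (topdual psi); last by exists 0.
  by have [c hc] := coordinate_total h; exists c.
(* The difference of two coordinates of [psi] is a coordinate of the zero functional, hence of
   modulus at most 0. *)
have uniq psi c c' : coordinate psi c -> coordinate psi c' -> c = c'.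
  move=> h h'; have := coordinate_le (coordinate_lin (-1) h h').
  rewrite scaleN1r addNr mulN1r sub0r -scaleNr => k.
  have t0 : topdual (- (- c + c') *: phi).
    by have := topdual_lin (- (- c + c') - 1) phi_topdual phi_topdual; rewrite scalerBl scale1r subrK.
  have := opnorm_ge0 t0; have := rnorm_ge0 (- c + c'); rewrite opnorm0 in k.
  move=> h1 h2; have /eqP : rnorm (- c + c') = 0 by lra.
  by rewrite rnorm_eq0 addrC subr_eq0 => /eqP.
exists e; split; [exact: phi_topdual|exact: phi_norm| | |].
- move=> a psi1 psi2 t1 t2; apply: uniq (he _ (topdual_lin a t1 t2)) _.
  by apply: coordinate_lin; exact: he.
- apply: uniq (he _ phi_topdual) _; exists g; split=> //.
  by apply: nearW => t _; rewrite mul1r.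
- by move=> psi tpsi; apply: coordinate_le; exact: he.
Qed.

End lindenstrauss_summand.

(** Complexify an extreme functional below the norm that agrees with it at [x0]; since [x0] is
    nonzero, its norm is exactly 1. *)
Lemma lindenstrauss_L_summand (R : realType) (F : normedModType R[i]) (x0 : F) :
  lindenstrauss F -> x0 != 0 ->
  exists phi e, L_summand phi e /\ phi x0 = (rnorm x0)%:C.
Proof.
move=> [d [T [mu [Phi [Ptop Plin Pnorm Psurj]]]]] x00.
have [l [ll lp lx0 lext]] := extreme_functional x0 (@sublinear_rnorm R F).
have [tphi phi_le] := complexify_topdual ll lp.
have phix0 : complexify l x0 = (rnorm x0)%:C.
  have h : rnorm (complexify l x0) <= complex.Re (complexify l x0) by rewrite /= lx0.
  rewrite (rnorm_le_Re h); congr (_%:C); apply/eqP; rewrite eq_le phi_le /=.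
  by rewrite -[leLHS]lx0; exact: (Re_le_rnorm (complexify l x0)).
have nphi : opnorm (complexify l) = 1.
  apply/eqP; rewrite eq_le; apply/andP; split.
    by apply: opnorm_le => x x1; exact: le_trans (phi_le x) x1.
  have nx : 0 < rnorm x0 by rewrite lt_neqAle eq_sym rnorm_eq0 x00 rnorm_ge0.
  have := le_opnorm x0 tphi; rewrite phix0 rnormC ger0_norm ?rnorm_ge0//.
  by rewrite -[leLHS]mul1r ler_pM2r.
have [g gL Pg] := Psurj _ tphi.
have [e he] := extreme_L_summand Ptop Plin Pnorm Psurj lext tphi nphi gL Pg.
by exists (complexify l), e.
Qed.

(** * Lifting finitely many constraints *)

Section L_summand_theory.
Context {R : realType} {F : normedModType R[i]}.
Variables (phi : F -> R[i]^o) (e : (F -> R[i]^o) -> R[i]^o).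
Hypothesis phi_e : L_summand phi e.

Let phi_topdual : topdual phi. Proof. by case: phi_e. Qed.

Lemma L_summand_normalized : exists y, phi y = 1.
Proof.
have [x phix] : exists x, phi x != 0.
  apply: contrapT => h; have [_ n1 _ _ _] := phi_e.
  have : opnorm phi <= 0.
    apply: opnorm_le => x _; have [->|nz] := eqVneq (phi x) 0; first by rewrite rnorm0.
    by exfalso; apply: h; exists x.
  by rewrite n1 ler10.
by exists ((phi x)^-1 *: x); rewrite topdualZ// mulVf.
Qed.

(** The pair [(x, a)] stands for [x + a e] in the bidual. With [r = psi - e psi *: phi] its value at
    [psi] is [r x + e psi * (phi x + a)], and [opnorm r] and [rnorm (e psi)] add up to at most
    [opnorm psi]. *)
Lemma rnorm_L_summand_le x psi (a : R[i]^o) (rho : R) : topdual psi ->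
  rnorm x <= rho -> rnorm (phi x + a) <= rho ->
  rnorm (psi x + a * e psi) <= opnorm psi * rho.
Proof.
move=> tpsi xr xar; have [_ _ _ _ /(_ psi tpsi) h] := phi_e.
pose r := psi - e psi *: phi.
have tr : topdual r by rewrite /r addrC -scaleNr; exact: topdual_lin.
have -> : psi x + a * e psi = r x + e psi * (phi x + a).
  by rewrite -[r x]/(psi x - e psi * phi x); ring.
rewrite (le_trans (rnormD _ _))//.
apply: (@le_trans _ _ (opnorm r * rho + rnorm (e psi) * rho)); last first.
  by rewrite -mulrDl addrC ler_wpM2r// (le_trans _ xr)// rnorm_ge0.
rewrite lerD//.
  by rewrite (le_trans (le_opnorm _ tr))// ler_wpM2l// opnorm_ge0.
by rewrite rnormM ler_wpM2l// rnorm_ge0.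
Qed.

Lemma L_summand0 : e 0 = 0.
Proof.
have [t _ el e1 _] := phi_e.
by have := el (-1) phi phi t t; rewrite scaleN1r addNr e1 mulr1 addNr.
Qed.

Lemma L_summand_sum n (psi : 'I_n -> F -> R[i]^o) (a : 'I_n -> R[i]) :
  (forall i, topdual (psi i)) ->
  topdual (\sum_i a i *: psi i) /\
  e (\sum_i a i *: psi i) = \sum_i a i * e (psi i).
Proof.
move=> tpsi; have [_ _ el _ _] := phi_e.
apply: (big_rec2 (fun p c => topdual p /\ e p = c)).
  split; last exact: L_summand0.
  by have := topdual_lin (-1) phi_topdual phi_topdual; rewrite scaleN1r addNr.
move=> i c p _ [tp <-]; split.
  exact: (topdual_lin (a i) (tpsi i) tp).
exact: (el (a i) _ _ (tpsi i) tp).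
Qed.

End L_summand_theory.

Lemma opnorm_adherent (R : realType) (F : normedModType R[i]) (psi : F -> R[i]^o)
    (d : R) : topdual psi -> 0 < d ->
  exists2 u, rnorm u <= 1 & opnorm psi - d < complex.Re (psi u).
Proof.
move=> tpsi d0; have [_ [x /= x1 <-] h] := sup_adherent d0 (opnorm_has_sup tpsi).
have [u u1 ux] := phase (psi x).
exists (u *: x); first by rewrite rnormZ u1 mul1r rnorm_le_normr.
by rewrite topdualZ// ux.
Qed.

Section lift.
Context {R : realType} {F : normedModType R[i]}.
Variables (phi : F -> R[i]^o) (e : (F -> R[i]^o) -> R[i]^o).
Hypothesis phi_e : L_summand phi e.
Variables (n : nat) (a : 'I_n -> R[i]).
Implicit Types w : 'I_n -> F.

Let phi_topdual : topdual phi. Proof. by case: phi_e. Qed.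

(** For [n = 0] the condition on [y] bounds nothing, so [0 <= c] is stated separately. *)
Let bounds w : set R :=
  [set c : R | 0 <= c /\ exists2 y, phi y = 0 & forall i, rnorm (w i + a i *: y) <= c].

(* The sup distance from [w] to the subspace of all [fun i => a i *: y] with
   [phi y = 0]. *)
Let dist w : R := inf (bounds w).

Let dist_le w c : bounds w c -> dist w <= c.
Proof. by move=> h; apply: ge_inf => //; exists 0 => b [b0 _]. Qed.

Let bounds_nonempty w : bounds w !=set0.
Proof.
exists (\sum_i rnorm (w i)); split; first by apply: sumr_ge0 => i _; exact: rnorm_ge0.
exists 0 => [|i]; first exact: topdual_linear0.
rewrite scaler0 addr0 (bigD1 i)//= lerDl; apply: sumr_ge0 => j _; exact: rnorm_ge0.
Qed.

Let le_dist w c : (forall d, bounds w d -> c <= d) -> c <= dist w.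
Proof. by move=> h; apply: lb_le_inf. Qed.

Let sublinear_dist : sublinear dist.
Proof.
split=> [w w'|t w t0].
  rewrite -lerBlDr; apply: le_dist => c [c0 [y y0 yc]].
  rewrite lerBlDr -lerBlDl; apply: le_dist => c' [c'0 [y' y'0 yc']].
  rewrite lerBlDl; apply: dist_le; split; first exact: addr_ge0.
  exists (y + y'); first by rewrite topdualD// y0 y'0 addr0.
  move=> i; rewrite scalerDr -[(w + w') i]/(w i + w' i) addrACA.
  by rewrite (le_trans (rnormD _ _))// lerD.
have [->|tn0] := eqVneq t 0.
  rewrite rmorph0 scale0r mul0r; apply: dist_le; split=> //.
  exists 0 => [|i]; first exact: topdual_linear0.
  by rewrite scaler0 addr0 rnorm0.
have t_gt0 : 0 < t by rewrite lt_neqAle eq_sym tn0.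
rewrite -ler_pdivrMl//; apply: le_dist => c [c0 [y y0 yc]].
rewrite ler_pdivrMl//; apply: dist_le; split; first exact: mulr_ge0.
exists (t%:C *: y); first by rewrite topdualZ// y0 mulr0.
move=> i; rewrite -[(_ *: w) i]/(t%:C *: w i) scalerA [a i * _]mulrC -scalerA -scalerDr.
by rewrite rnormZr ger0_norm// ler_wpM2l.
Qed.

(** Hahn-Banach duality: the distance from a first lift [w0] to the admissible shifts is the real
    part at [w0] of a functional [L] vanishing on the shifts, with components [psi i] whose norms
    sum to at most 1. Using [e], [L w0] becomes a sum to which [rnorm_L_summand_le] applies
    termwise. *)
Lemma L_summand_lift (x : 'I_n -> F) (rho d : R) : 0 <= rho -> 0 < d ->
  (forall i, rnorm (x i) <= rho) -> (forall i, rnorm (phi (x i) + a i : R[i]^o) <= rho) ->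
  exists2 y, phi y = 1 & forall i, rnorm (x i + a i *: y) < rho + d.
Proof.
move=> rho0 d0 xr xar.
have [y0 phiy0] := L_summand_normalized phi_e.
pose w0 i := x i + a i *: y0.
suff : dist w0 <= rho.
  move=> h; have [|c [c0 [y y0' hy]] cd] := @inf_lt _ (bounds w0) (rho + d) (bounds_nonempty w0).
    by rewrite (le_lt_trans h)// ltrDl.
  exists (y0 + y); first by rewrite topdualD// phiy0 y0' addr0.
  by move=> i; rewrite scalerDr addrA (le_lt_trans (hy i)).
have [l [ll lp lw0 _]] := extreme_functional w0 sublinear_dist.
pose L : {linear ('I_n -> F) -> R[i]^o} :=
  HB.pack (complexify l) (GRing.isLinear.Build _ _ _ _ _ (complexify_linear ll)).
have ReL w : complex.Re (L w) = l w by [].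
pose single i (z : F) : 'I_n -> F := fun j => if j == i then z else 0.
have singleE w : w = \sum_i single i (w i).
  apply/funext => j; rewrite fct_sumE (bigD1 j)//= /single eqxx big1 ?addr0// => i ij.
  by rewrite eq_sym (negbTE ij).
have single_lin i : linear (single i).
  move=> b u z; apply/funext => j; rewrite -[RHS]/(b *: single i u j + single i z j).
  by rewrite /single; case: ifP => // _; rewrite scaler0 addr0.
pose psi i (z : F) : R[i]^o := L (single i z).
have psi_lin i : linear (psi i) by move=> b u z; rewrite /psi single_lin linearP.
have psi_le i z : rnorm (psi i z) <= 1 * rnorm z.
  apply: linear_bound_Re => // {}z; rewrite mul1r /psi ReL (le_trans (lp _))//.
  apply: dist_le; split; first exact: rnorm_ge0.
  exists 0 => [|j]; first exact: topdual_linear0.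
  by rewrite scaler0 addr0 /single; case: ifP => // _; rewrite rnorm0 rnorm_ge0.
have tpsi i : topdual (psi i) by split=> //; exact: linear_bound_continuous (psi_le i).
have LE w : L w = \sum_i psi i (w i) by rewrite {1}(singleE w) linear_sum.
have ker y : phi y = 0 -> L (fun i => a i *: y) = 0.
  move=> phiy; have [u u1 ux] := phase (L (fun i => a i *: y)).
  have : complex.Re (L (fun i => a i *: (u *: y))) <= 0.
    rewrite ReL (le_trans (lp _))//; apply: dist_le; split => //.
    exists (- (u *: y)); first by rewrite topdualN// topdualZ// phiy mulr0 oppr0.
    by move=> i; rewrite scalerN subrr rnorm0.
  rewrite (_ : (fun i => _) = u *: (fun i => a i *: y)); last first.
    by apply/funext => i; rewrite !scalerA mulrC -scalerA.
  rewrite linearZ -[X in complex.Re X]/(u * _) ux => h.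
  by apply/eqP; rewrite -rnorm_eq0 eq_le h rnorm_ge0.
pose c := L (fun i => a i *: y0).
(* A functional vanishing on the kernel of [phi] is a multiple of [phi]; the factor is its value at
   [y0]. *)
have sumE : \sum_i a i *: psi i = c *: phi.
  apply/funext => y; rewrite fct_sumE.
  transitivity (L (fun i => a i *: y)).
    by rewrite LE; apply: eq_bigr => i _; exact: (esym (topdualZ (a i) y (tpsi i))).
  have := ker (y - phi y *: y0); rewrite topdualB// topdualZ// phiy0 mulr1 subrr => /(_ erefl).
  rewrite (_ : (fun i => _) = (fun i => a i *: y) - phi y *: (fun i => a i *: y0)); last first.
    apply/funext => i; rewrite -[RHS]/(a i *: y - phi y *: (a i *: y0)).
    by rewrite scalerBr !scalerA mulrC.
  by rewrite linearB linearZ => /subr0_eq ->; rewrite -[RHS]/(c * phi y) mulrC.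
have ec : \sum_i a i * e (psi i) = c.
  have [_ <-] := L_summand_sum phi_e a tpsi; rewrite sumE.
  have [_ _ el e1 _] := phi_e.
  have t0 : topdual (0 : F -> R[i]^o).
    by have := topdual_lin (-1) phi_topdual phi_topdual; rewrite scaleN1r addNr.
  by have := el c phi 0 phi_topdual t0; rewrite !addr0 e1 mulr1 (L_summand0 phi_e) addr0.
(* Almost norming vectors of the components form one family [u] of sup norm at most 1; the slacks
   [g / (n + 1)] total at most [g]. *)
have sum_opnorm : \sum_i opnorm (psi i) <= 1.
  apply/ler_addgt0Pr => g g0.
  have gn0 : 0 < g / n.+1%:R by rewrite divr_gt0.
  have /choice[u hu] i : exists z, rnorm z <= 1 /\ opnorm (psi i) - g / n.+1%:R < complex.Re (psi i z).
    by have [z z1 hz] := opnorm_adherent (tpsi i) gn0; exists z.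
  have lu : l u <= 1.
    rewrite (le_trans (lp _))//; apply: dist_le; split=> //.
    exists 0 => [|j]; first exact: topdual_linear0.
    by rewrite scaler0 addr0; case: (hu j).
  have : \sum_i (opnorm (psi i) - g / n.+1%:R) <= l u.
    rewrite -ReL LE raddf_sum; apply: ler_sum => i _; apply: ltW.
    by case: (hu i).
  rewrite big_split/= sumr_const card_ord => h.
  have : g / n.+1%:R *+ n <= g.
    rewrite -mulr_natr mulrAC ler_pdivrMr// ler_pM2l// ler_nat//.
  move: h lu; rewrite mulNrn; move: (_ *+ n) => k; lra.
rewrite -lw0 -ReL LE.
(* The contribution of the arbitrary [y0] to [L w0] is [c], which [ec] expresses through [e]. *)
have -> : \sum_i psi i (w0 i) = \sum_i (psi i (x i) + a i * e (psi i)).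
  rewrite big_split/= ec /c LE -big_split/=; apply: eq_bigr => i _.
  exact: (topdualD (x i) (a i *: y0) (tpsi i)).
rewrite (le_trans (Re_le_rnorm _))//.
apply: (@le_trans _ _ (\sum_i opnorm (psi i) * rho)); last first.
  by rewrite -mulr_suml ler_piMl.
apply: (@le_trans _ _ (\sum_i rnorm (psi i (x i) + a i * e (psi i) : R[i]^o))).
  elim/big_ind2 : _ => [|u1 u2 z1 z2 h1 h2|//]; first by rewrite rnorm0.
  by rewrite (le_trans (rnormD _ _))// lerD.
apply: ler_sum => i _; exact: (rnorm_L_summand_le phi_e (tpsi i) (xr i) (xar i)).
Qed.

End lift.

(** * Compactness *)

Section rnorm_topology.
Context {R : realType} {V : normedModType R[i]}.

Lemma ball_rnorm (x y : V) (e : R) : ball x e%:C y <-> rnorm (x - y) < e.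
Proof. by rewrite -ball_normE /ball_ /= rnormE ltcR. Qed.

Lemma near_rnorm (x : V) (e : R) : 0 < e -> \forall y \near x, rnorm (x - y) < e.
Proof.
move=> e0; apply: filterS (nbhsx_ballx x (e%:C : R[i]) _); last by rewrite ltcR.
by move=> y /ball_rnorm.
Qed.

Lemma rnorm_dist_le (x y : V) : `|rnorm x - rnorm y| <= rnorm (x - y).
Proof.
rewrite ler_norml; apply/andP; split.
  have := rnormD (y - x) x; rewrite subrK -[rnorm (y - x)]rnormN opprB; lra.
by have := rnormD (x - y) y; rewrite subrK; lra.
Qed.

Lemma rnorm_continuous : continuous (@rnorm R V : V -> R).
Proof.
move=> x; apply/cvgrPdist_lt => e e0.
apply: filterS (near_rnorm x e0) => y; apply: le_lt_trans; exact: rnorm_dist_le.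
Qed.

Lemma closed_rnorm_le (c : R) : closed [set x : V | rnorm x <= c].
Proof.
apply: (@closed_comp _ _ (@rnorm R V) [set y | y <= c]); last exact: closed_le.
by move=> x _; exact: rnorm_continuous.
Qed.

Lemma cvg_rnormP (T : Type) (Fl : set_system T) (FFl : Filter Fl) (f : T -> V) (x : V) :
  (forall e : R, 0 < e -> \forall t \near Fl, rnorm (x - f t) < e) -> f @ Fl --> x.
Proof.
move=> h; apply/cvgrPdist_lt => e e0.
have eE : e = (complex.Re e)%:C by rewrite RRe_real// gtr0_real.
have re0 : 0 < complex.Re e by rewrite -ltcR -eE.
by apply: filterS (h _ re0) => t; rewrite eE rnormE ltcR.
Qed.

End rnorm_topology.

Section complex_disc.
Context {R : realType}.

Lemma compact_disc : compact [set b : R[i]^o | rnorm b <= 1].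
Proof.
pose f (p : R * R) : R[i]^o := p.1 +i* p.2.
have cf : continuous f.
  move=> p; apply: cvg_rnormP => e e0.
  have e2 : 0 < e / 2 by rewrite divr_gt0.
  have h1 : \forall q \near p, `|p.1 - q.1| < e / 2.
    have c : (fun q : R * R => q.1) q @[q --> p] --> p.1 by exact: cvg_fst.
    by have /cvgrPdist_lt/(_ _ e2) := c.
  have h2 : \forall q \near p, `|p.2 - q.2| < e / 2.
    have c : (fun q : R * R => q.2) q @[q --> p] --> p.2 by exact: cvg_snd.
    by have /cvgrPdist_lt/(_ _ e2) := c.
  apply: filterS2 h1 h2 => q; case: p q => [a b] [c d] /= h1 h2.
  have -> : f (a, b) - f (c, d) = (a - c)%:C + 'i * (b - d)%:C.
    by rewrite /f /=; simpc.
  rewrite (le_lt_trans (rnormD _ _))// rnormM !rnormC rnorm_i.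
  lra.
apply: (@subclosed_compact _ _ (f @` (`[-1, 1] `*` `[-1, 1]))).
- exact: closed_rnorm_le.
- apply: continuous_compact; first exact: continuous_subspaceT.
  by apply: compact_setX; exact: segment_compact.
move=> b /= b1; exists (complex.Re b, complex.Im b); last by case: b b1.
have hr := normRe_le_rnorm b.
have hi : `|complex.Im b| <= rnorm b.
  have := normRe_le_rnorm ('i * b : R[i]^o); rewrite rnormM rnorm_i mul1r.
  by case: b {hr b1} => x y /=; rewrite mul0r mul1r sub0r normrN.
by split; rewrite /= in_itv /= -ler_norml (le_trans _ b1).
Qed.

End complex_disc.

Lemma compact_net (R : realType) (V W : normedModType R[i]) (K : set (V * W)) (e : R) :
  compact K -> 0 < e ->
  exists2 s : seq (V * W), (forall p, p \in s -> K p) &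
    forall p, K p -> exists2 q, q \in s & rnorm (q.1 - p.1) < e /\ rnorm (q.2 - p.2) < e.
Proof.
move=> cK e0; pose T : ptopologicalType := HB.pack (V * W)%type.
have {}cK : @cover_compact T K by rewrite -compact_cover.
have ec0 : (0 : R[i]) < e%:C by rewrite ltcR.
have [|D DK Kc] := cK _ K (fun p : V * W => (ball p (e%:C : R[i]))^°) (fun p _ => open_interior _).
  by move=> p Kp; exists p => //; exact: nbhsx_ballx.
exists (finmap.enum_fset D); first by move=> p /DK; rewrite inE.
move=> p /Kc[q Dq /interior_subset[/ball_rnorm h1 /ball_rnorm h2]].
by exists q.
Qed.

(** * Contractive correction on a compact set *)

Lemma half_pow_le0 (R : realType) (x M : R) :
  (forall k, x <= M / 2 ^+ k) -> x <= 0.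
Proof.
move=> h; rewrite leNgt; apply/negP => x0.
have M0 : 0 < M by have := h 0%N; rewrite expr0 divr1; exact: lt_le_trans.
have hb := archi_boundP (ltW (divr_gt0 M0 x0)).
have := h (Num.bound (M / x)); rewrite ler_pdivlMr ?exprn_gt0//.
rewrite leNgt => /negP; apply; rewrite mulrC -ltr_pdivrMr//.
by rewrite (lt_trans hb)// -natrX ltr_nat ltn_expl.
Qed.

(** Here [r] is the whole coefficient of the kernel component; the applications put [1 - r] in its
    place. *)
Lemma correction_continuous (R : realType) (F : normedModType R[i])
    (phi : F -> R[i]^o) (y q : F) (r : R[i]) : topdual phi ->
  continuous (fun p : F * R[i]^o => r *: (p.1 - phi p.1 *: y) + p.2 *: q).
Proof.
move=> tphi p.
have c1 : (fun q : F * R[i]^o => q.1) q @[q --> p] --> p.1 by exact: cvg_fst.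
have c2 : (fun q : F * R[i]^o => q.2) q @[q --> p] --> p.2 by exact: cvg_snd.
have cphi : (fun q : F * R[i]^o => phi q.1) q @[q --> p] --> phi p.1.
  exact: (cvg_comp (fun q : F * R[i]^o => q.1) phi c1 (tphi.2 p.1)).
exact: (cvgD (cvgZl_tmp (k := r) (cvgB c1 (cvgZr_tmp (a := y) cphi)))
  (cvgZr_tmp (a := q) c2)).
Qed.

Lemma compact_image_pair (S T W : topologicalType) (K : set S) (f : S -> T)
    (g : S -> W) :
  compact K -> continuous f -> continuous g -> compact [set (f p, g p) | p in K].
Proof.
move=> cK cf cg; apply: continuous_compact => //; apply: continuous_subspaceT => p.
exact: (cvg_pair (cf p) (cg p)).
Qed.

Section compact_lift.
Context {R : realType} {F : normedModType R[i]}.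
Variables (phi : F -> R[i]^o) (e : (F -> R[i]^o) -> R[i]^o).
Hypothesis phi_e : L_summand phi e.
Let phi_topdual : topdual phi. Proof. by case: phi_e. Qed.

(** A lift for a finite net serves all of [K] because [y] is bounded independently of the net: the
    excess is [d / 2] on the net, plus [d / 8 + 2 * (d / 8)] for the approximation. *)
Lemma L_summand_compact_lift (K : set (F * R[i]^o)) (rho d : R) :
  compact K -> 0 < d -> d <= rho -> rho <= 1 ->
  (forall x a, K (x, a) -> rnorm x <= rho /\ rnorm (phi x + a) <= rho) ->
  exists y, [/\ phi y = 1, rnorm y <= 2 &
    forall x a, K (x, a) -> rnorm (x + a *: y) <= rho + d].
Proof.
move=> cK d0 drho rho1 hK.
have d8 : 0 < d / 8 by rewrite divr_gt0.
have [s sK hs] := compact_net cK d8.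
have rho0 : 0 < rho by exact: lt_le_trans drho.
(* Adding this pair to the net gives [rho * rnorm y <= rho + d / 2], whence [rnorm y <= 2]. *)
pose p0 : F * R[i]^o := (0, rho%:C).
pose t := p0 :: s.
have ht p : p \in t -> rnorm p.1 <= rho /\ rnorm (phi p.1 + p.2) <= rho.
  rewrite inE => /orP[/eqP ->|/sK]; last by case: p => x a /hK.
  by rewrite /= rnorm0 topdual_linear0// add0r rnormC gtr0_norm// (ltW rho0).
have d2 : 0 < d / 2 by rewrite divr_gt0.
have ti (i : 'I_(size t)) : nth p0 t i \in t by rewrite mem_nth.
have [||y phiy hy] := L_summand_lift phi_e (n := size t)
    (a := fun i => (nth p0 t i).2) (x := fun i => (nth p0 t i).1) (ltW rho0) d2.
- by move=> i; case: (ht _ (ti i)).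
- by move=> i; case: (ht _ (ti i)).
have {}hy p : p \in t -> rnorm (p.1 + p.2 *: y) <= rho + d / 2.
  move=> pt; have it : (index p t < size t)%N by rewrite index_mem.
  by have := hy (Ordinal it); rewrite /= nth_index// => /ltW.
have y2 : rnorm y <= 2.
  have := hy p0 (mem_head _ _); rewrite /= add0r rnormZr gtr0_norm// => h.
  have : rho * rnorm y <= rho * 2 by lra.
  by rewrite ler_pM2l.
exists y; split=> // x a /[dup] Kxa /hs[[x' a'] /= st [xx aa]].
have h := hy (x', a'); rewrite inE st orbT in h; have {h} /= h := h isT.
have -> : x + a *: y = (x' + a' *: y) - ((x' - x) + (a' - a) *: y).
  by rewrite scalerBl [(x' - x) + _]addrACA -opprD opprB [RHS]addrC subrK.
rewrite (le_trans (rnormB _ _))//.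
have := rnormD (x' - x) ((a' - a) *: y); rewrite rnormZ.
have : rnorm (a' - a : R[i]^o) * rnorm y <= d / 8 * 2.
  by apply: ler_pM => //; rewrite ?rnorm_ge0// ltW.
lra.
Qed.

End compact_lift.

(** * From approximate to exact lifts by completeness *)

Section contractive_lift.
Context {R : realType} {F : completeNormedModType R[i]}.
Variables (phi : F -> R[i]^o) (e : (F -> R[i]^o) -> R[i]^o).
Hypothesis phi_e : L_summand phi e.
Let phi_topdual : topdual phi. Proof. by case: phi_e. Qed.
Let phi_le x : rnorm (phi x) <= rnorm x.
Proof. by have := le_opnorm x phi_topdual; case: phi_e => _ -> _ _ _; rewrite mul1r. Qed.

Section iteration.
Variables (K : set (F * R[i]^o)) (r : R) (y : F).
Hypothesis cK : compact K.
Hypothesis r0 : 0 < r.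
Hypothesis r2 : r <= 2^-1.
Hypothesis K1 : forall x b, K (x, b) -> rnorm x <= 1 /\ rnorm b <= 1.
Hypothesis phiy : phi y = 1.

Let base (x : F) : F := (1 - r)%:C *: (x - phi x *: y).
(* At stage [k], [phi] maps [base x + b *: q] to [b] up to the factor
   [1 - r / 2 ^+ k], and half of this defect is kept as room in the norm bound. *)
Let approx (k : nat) (q : F) : Prop :=
  phi q = (1 - r / 2 ^+ k)%:C /\
  forall x b, K (x, b) -> rnorm (base x + b *: q) <= 1 - r / 2 ^+ k.+1.

Let phi_base x : phi (base x) = 0.
Proof. by rewrite topdualZ// topdualB// topdualZ// phiy mulr1 subrr mulr0. Qed.

(** Lift the pairs [(base x + b q, s b)], with [s] half the defect [r / 2 ^ k]: the vectors, and
    their [phi]-images increased by [s b], are bounded by [1 - s]. Adding [s z] to [q] halves the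
    defect, and the slack [s / 2] yields the bound [1 - s / 2] of the next stage. *)
Let approx_step k q : approx k q ->
  exists2 q', approx k.+1 q' & rnorm (q' - q) <= r / 2 ^+ k.
Proof.
move=> [phiq hq].
pose s : R := r / 2 ^+ k.+1.
have s_half : s / 2 = r / 2 ^+ k.+2 by rewrite /s -mulrA -invfM -exprSr.
have s_dbl : s + s = r / 2 ^+ k.
  rewrite /s exprSr invfM mulrA; set u := r / _; lra.
have s0 : 0 < s by rewrite divr_gt0// exprn_gt0.
have s1 : s <= 2^-1.
  apply: le_trans r2; rewrite ler_pdivrMr ?exprn_gt0// ler_peMr ?(ltW r0)//.
  by rewrite exprn_ege1// ler1n.
have cs : continuous (fun p : F * R[i]^o => s%:C *: p.2 : R[i]^o).
  move=> p; have c2 : (fun q : F * R[i]^o => q.2) q @[q --> p] --> p.2 by exact: cvg_snd.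
  exact: (cvgZl_tmp (k := s%:C) c2).
have cK' := compact_image_pair cK (@correction_continuous _ _ _ y q (1 - r)%:C phi_topdual) cs.
have [||||z [phiz z2 hz]] := L_summand_compact_lift phi_e (rho := 1 - s) (d := s / 2) cK'.
- by rewrite divr_gt0.
- lra.
- lra.
- move=> _ _ [[x b] Kxb [<- <-]]; have [x1 b1] := K1 Kxb; split; first exact: hq.
  have e1 : phi (base x + b *: q) = b * (1 - r / 2 ^+ k)%:C.
    by rewrite topdualD// phi_base add0r topdualZ// phiq.
  rewrite -[leLHS]/(rnorm (phi (base x + b *: q) + s%:C * b : R[i]^o)) e1.
  rewrite [s%:C * _]mulrC -mulrDr -rmorphD -s_dbl rnormM rnormC.
  rewrite (_ : 1 - _ + s = 1 - s); last by ring.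
  rewrite ger0_norm; last by lra.
  by rewrite ler_piMl//; lra.
exists (q + s%:C *: z); last first.
  rewrite addrC addKr rnormZr gtr0_norm// -s_dbl.
  have : s * rnorm z <= s * 2 by rewrite ler_pM2l.
  lra.
split.
  rewrite topdualD// topdualZ// phiz mulr1 phiq -rmorphD -s_dbl; congr (_%:C).
  by rewrite -/s; ring.
move=> x b Kxb; have := hz (base x + b *: q) (s%:C * b).
rewrite scalerDr addrA -s_half.
have -> : b *: (s%:C *: z) = (s%:C * b) *: z.
  by rewrite scalerA mulrC.
move=> h; rewrite (le_trans (h _))//; last by lra.
by exists (x, b).
Qed.

(** The stages form a Cauchy sequence, with increments at most [r / 2 ^ k]; in the limit the defect
    and the spare room both vanish. *)
Lemma iterated_lift : (forall x b, K (x, b) ->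
    rnorm (x + (b - phi x) *: y) <= 1 + r / 2) ->
  exists q, [/\ phi q = 1, rnorm (q - (1 - r)%:C *: y) <= 2 * r &
    forall x b, K (x, b) -> rnorm ((1 - r)%:C *: (x - phi x *: y) + b *: q) <= 1].
Proof.
move=> hy; pose q0 := (1 - r)%:C *: y.
have r1 : 0 <= 1 - r by rewrite subr_ge0 (le_trans r2)// invf_le1// ler1n.
(* [base x + b q0] is [1 - r] times the vector bounded by hypothesis, and
   [(1 - r) (1 + r / 2) <= 1 - r / 2]. *)
have a0 : approx 0 q0.
  split; first by rewrite topdualZ// phiy mulr1 expr0 divr1.
  move=> x b Kxb; have -> : base x + b *: q0 = (1 - r)%:C *: (x + (b - phi x) *: y).
    rewrite /base /q0 scalerA [b * _]mulrC -scalerA -scalerDr scalerBl; congr (_ *: _).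
    by rewrite addrAC addrA.
  rewrite rnormZr (ger0_norm r1).
  have : (1 - r) * rnorm (x + (b - phi x) *: y) <= (1 - r) * (1 + r / 2).
    by apply: ler_wpM2l; [exact: r1|exact: hy].
  have -> : (1 - r) * (1 + r / 2) = 1 - r / 2 - r ^+ 2 / 2 by field.
  have := sqr_ge0 r; rewrite [2 ^+ 1]expr1; move: (r ^+ 2) (rnorm _) => u w; lra.
have /choice[step hstep] (p : nat * F) : exists q', approx p.1 p.2 ->
    approx p.1.+1 q' /\ rnorm (q' - p.2) <= r / 2 ^+ p.1.
  have [h|h] := pselect (approx p.1 p.2); last by exists 0.
  by have [q' ? ?] := approx_step h; exists q'.
pose q := fix q k := if k is k'.+1 then step (k', q k') else q0.
have aq k : approx k (q k).
  by elim: k => // k ih; have [] := hstep (k, q k) ih.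
have dq k : rnorm (q k.+1 - q k) <= r / 2 ^+ k.
  by have [] := hstep (k, q k) (aq k).
(* The exact geometric sum is kept so that the induction on [m] closes. *)
have dqn k m : rnorm (q (k + m)%N - q k) <= 2 * r / 2 ^+ k - 2 * r / 2 ^+ (k + m).
  elim: m => [|m ih]; first by rewrite addn0 !subrr rnorm0.
  have -> : q (k + m.+1)%N - q k = (q (k + m).+1 - q (k + m)%N) + (q (k + m)%N - q k).
    by rewrite addnS addrA subrK.
  rewrite (le_trans (rnormD _ _))//.
  have : 2 * r / 2 ^+ (k + m.+1) = r / 2 ^+ (k + m).
    by rewrite addnS exprS invfM mulrACA divff// mul1r.
  have : 2 * r / 2 ^+ (k + m) = 2 * (r / 2 ^+ (k + m)) by rewrite mulrA.
  have := dq (k + m)%N; lra.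
have dqk k n : (k <= n)%N -> rnorm (q n - q k) <= 2 * r / 2 ^+ k.
  move=> /subnKC <-; rewrite (le_trans (dqn _ _))// gerBl.
  by rewrite divr_ge0// ?exprn_ge0// mulr_ge0// ltW.
have cvg_q : cvg (q n @[n --> \oo]).
  apply/cauchy_cvgP/cauchy_exP => g g0.
  have gE : g = (complex.Re g)%:C by rewrite RRe_real// gtr0_real.
  have rg0 : 0 < complex.Re g by rewrite -ltcR -gE.
  have [k hk] : exists k, 2 * r / 2 ^+ k < complex.Re g.
    apply: contrapT => h; have : complex.Re g <= 0.
      apply: (@half_pow_le0 _ _ (2 * r)) => k; rewrite leNgt; apply/negP => hk.
      by apply: h; exists k.
    by rewrite leNgt rg0.
  exists (q k); exists k => // n /= kn; rewrite gE; apply/ball_rnorm.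
  by rewrite -rnormN opprB (le_lt_trans (dqk _ _ kn)).
pose l := lim (q n @[n --> \oo]).
have dl k : rnorm (l - q k) <= 2 * r / 2 ^+ k.
  apply/ler_addgt0Pr => g g0.
  have gc : (0 : R[i]) < g%:C by rewrite ltcR.
  have /cvgrPdist_lt/(_ _ gc)[N _ hN] := cvg_q.
  have := hN (maxn N k) (leq_maxl _ _); rewrite /= -/l rnormE ltcR => h1.
  have h2 := dqk _ _ (leq_maxr N k).
  have -> : l - q k = (l - q (maxn N k)) + (q (maxn N k) - q k) by rewrite addrA subrK.
  by rewrite (le_trans (rnormD _ _))//; lra.
exists l; split.
- apply/eqP; rewrite -subr_eq0 -rnorm_eq0 eq_le rnorm_ge0 andbT.
  (* [2 * r] comes from the tail of the sequence and [r] from the defect of [phi (q k)]. *)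
  apply: (@half_pow_le0 _ _ (3 * r)) => k.
  have -> : phi l - 1 = phi (l - q k) - (r / 2 ^+ k)%:C.
    by rewrite topdualB// (aq k).1 rmorphB rmorph1 opprB; ring.
  rewrite (le_trans (rnormB _ _))// rnormC ger0_norm; last first.
    by rewrite divr_ge0 ?exprn_ge0// ltW.
  have -> : 3 * r / 2 ^+ k = 2 * r / 2 ^+ k + r / 2 ^+ k by rewrite -mulrDl; congr (_ / _); ring.
  by rewrite lerD// (le_trans (phi_le _)).
- by have := dl 0%N; rewrite expr0 divr1.
- move=> x b Kxb; have [_ b1] := K1 Kxb.
  rewrite -subr_le0; apply: (@half_pow_le0 _ _ (2 * r)) => k.
  have -> : base x + b *: l = (base x + b *: q k) + b *: (l - q k).
    by rewrite scalerBr -addrA [b *: q k + _]addrC subrK.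
  have h1 := (aq k).2 _ _ Kxb.
  have h2 := rnormD (base x + b *: q k) (b *: (l - q k)).
  have h3 : rnorm (b *: (l - q k)) <= 2 * r / 2 ^+ k.
    rewrite rnormZ (le_trans _ (dl k))// ler_piMl ?rnorm_ge0//.
  have h4 : 0 <= r / 2 ^+ k.+1 by rewrite divr_ge0 ?exprn_ge0// ltW.
  lra.
Qed.

End iteration.

(** [y] lifts the pairs [(x, b - phi x)], for which [phi x + (b - phi x) = b] stays in the disc;
    iterating from [(1 - r) y] gives [q]. *)
Lemma L_summand_contractive_lift (K : set (F * R[i]^o)) (r : R) :
  compact K -> 0 < r -> r <= 2^-1 ->
  (forall x b, K (x, b) -> rnorm x <= 1 /\ rnorm b <= 1) ->
  exists y q, [/\ phi y = 1, phi q = 1 & forall x b, K (x, b) ->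
    rnorm ((1 - r)%:C *: (x - phi x *: y) + b *: q) <= 1 /\
    rnorm (x - ((1 - r)%:C *: (x - phi x *: y) + b *: q)) <=
      3 * r + 2 * rnorm (b - phi x)].
Proof.
move=> cK r0 r2 K1.
have c2 : continuous (fun p : F * R[i]^o => p.2 - phi p.1).
  move=> p; apply: cvgB; first exact: cvg_snd.
  have cp : (fun q : F * R[i]^o => q.1) q @[q --> p] --> p.1 by exact: cvg_fst.
  exact: (cvg_comp (fun q : F * R[i]^o => q.1) phi cp (phi_topdual.2 p.1)).
have c1 : continuous (fun p : F * R[i]^o => p.1) by move=> p; exact: cvg_fst.
have cK' := compact_image_pair cK c1 c2.
have [||||y [phiy y2 hy]] := L_summand_compact_lift phi_e (rho := 1) (d := r / 2) cK'.
- by rewrite divr_gt0.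
- lra.
- lra.
- move=> _ _ [[x b] Kxb [<- <-]]; have [x1 b1] := K1 _ _ Kxb; split=> //=.
  by rewrite addrC subrK.
have [|q [phiq q2 hq]] := iterated_lift cK r0 r2 K1 phiy.
  by move=> x b Kxb; apply: hy; exists (x, b).
exists y, q; split=> // x b Kxb; split; first exact: hq.
have [x1 b1] := K1 _ _ Kxb.
set c := (1 - r)%:C in q2 *.
(* Three errors: shrinking [x] costs [r], changing the [phi]-value costs [2 * rnorm (b - phi x)] as
   [rnorm y <= 2], and passing from [c *: y] to [q] costs [2 * r]. *)
have -> : x - (c *: (x - phi x *: y) + b *: q) =
    r%:C *: x - c *: ((b - phi x) *: y) - b *: (q - c *: y).
  have -> : r%:C = 1 - c by rewrite /c rmorphB rmorph1 opprB addrC subrK.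
  rewrite !(scalerBr, scalerBl) scale1r [b *: (c *: y)]scalerA [b * c]mulrC -scalerA.
  move: (c *: x) (c *: (phi x *: y)) (c *: (b *: y)) (b *: q) => P Q B D.
  rewrite !opprB -[RHS]addrA [(Q - B) + _]addrA subrK opprD opprB -!addrA.
  by rewrite (addrCA Q (- P)).
rewrite (le_trans (rnormB _ _))// (_ : 3 * r + _ = (r + 2 * rnorm (b - phi x)) + 2 * r); last by ring.
have hx : rnorm (r%:C *: x) <= r by rewrite rnormZr gtr0_norm// ler_piMr// ltW.
have hb : rnorm (b *: (q - c *: y)) <= 2 * r.
  by rewrite rnormZ (le_trans _ q2)// ler_piMl// rnorm_ge0.
have hm : rnorm (c *: ((b - phi x) *: y)) <= 2 * rnorm (b - phi x).
  rewrite rnormZr rnormZ ger0_norm; last by lra.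
  apply: (@le_trans _ _ (rnorm (b - phi x) * rnorm y)).
    by rewrite ler_piMl ?mulr_ge0 ?rnorm_ge0//; lra.
  by rewrite mulrC ler_wpM2r ?rnorm_ge0.
have := rnormB (r%:C *: x) (c *: ((b - phi x) *: y)); lra.
Qed.

End contractive_lift.

(** * Weighted holomorphic mappings *)

Section vnorm_theory.
Context {R : realType} {E F : normedModType R[i]}.
Variables (U : set E) (v : E -> R).
Implicit Types f : E -> F.

Lemma le_vnorm f w : has_ubound (vvalues U v f) -> U w ->
  v w * rnorm (f w) <= vnorm U v f.
Proof. by move=> fb Uw; apply: ub_le_sup => //; exists w. Qed.

Lemma vnorm_le f (M : R) : U !=set0 ->
  (forall w, U w -> v w * rnorm (f w) <= M) -> vnorm U v f <= M.
Proof.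
move=> [w Uw] h; apply: sup_le_ub; first by exists (v w * rnorm (f w)), w.
by move=> _ [x Ux <-]; exact: h.
Qed.

Lemma vvalues_ubound f (M : R) :
  (forall w, U w -> v w * rnorm (f w) <= M) -> has_ubound (vvalues U v f).
Proof. by move=> h; exists M => _ [w Uw <-]; exact: h. Qed.

Lemma vnormZ f (c : R) : U !=set0 -> 0 < c -> has_ubound (vvalues U v f) ->
  has_ubound (vvalues U v (c%:C *: f)) /\ vnorm U v (c%:C *: f) = c * vnorm U v f.
Proof.
move=> U0 c0 fb.
have valZ w : v w * rnorm ((c%:C *: f) w) = c * (v w * rnorm (f w)).
  by rewrite -[(_ *: _) w]/(c%:C *: f w) rnormZr gtr0_norm// mulrCA.
have ub : has_ubound (vvalues U v (c%:C *: f)).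
  apply: (vvalues_ubound (M := c * vnorm U v f)) => w Uw.
  by rewrite valZ ler_pM2l// le_vnorm.
split=> //; apply/eqP; rewrite eq_le; apply/andP; split.
  by apply: vnorm_le => // w Uw; rewrite valZ ler_pM2l// le_vnorm.
rewrite -ler_pdivlMl//; apply: vnorm_le => // w Uw.
by rewrite ler_pdivlMl// -valZ le_vnorm.
Qed.

End vnorm_theory.

Lemma topdual_differentiable (R : realType) (F : normedModType R[i])
    (phi : F -> R[i]^o) (x : F) : topdual phi -> differentiable phi x.
Proof.
move=> [lphi cphi].
pose L : {linear F -> R[i]^o} :=
  HB.pack phi (GRing.isLinear.Build _ _ _ _ phi lphi).
exact: (@linear_differentiable _ _ _ L x cphi).
Qed.

Lemma holomorphic_on_correction (R : realType) (E F : normedModType R[i])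
    (U : set E) (phi : F -> R[i]^o) (f : E -> F) (g : E -> R[i]^o) (r : R[i]) (y q : F) :
  topdual phi -> holomorphic_on U f -> holomorphic_on U g ->
  holomorphic_on U (fun w => r *: (f w - phi (f w) *: y) + g w *: q).
Proof.
move=> tphi hf hg w Uw.
have df := hf w Uw; have dg := hg w Uw.
have dphi : differentiable (fun w => phi (f w)) w.
  exact: (differentiable_comp df (topdual_differentiable (f w) tphi)).
apply: (@differentiableD _ _ _ (fun w => r *: (f w - phi (f w) *: y)) (fun w => g w *: q)).
  apply: (@differentiableZ _ _ _ (fun w => f w - phi (f w) *: y)).
  apply: (@differentiableB _ _ _ f (fun w => phi (f w) *: y)) => //.
  exact: (@differentiableZl _ _ _ (fun w => phi (f w)) y w dphi).
exact: (@differentiableZl _ _ _ g q w dg).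
Qed.

(** * Transfer of the property from scalar to vector-valued mappings *)

Theorem theorem3p5 (R : realType) (E : completeNormedModType R[i])
    (U : set E) (v : E -> R) (hU : open U) (hv : weight U v)
    (hBPB : WH_BPB U v (Hv U v : set (E -> R[i]^o)))
    (F : completeNormedModType R[i]) (hF : lindenstrauss F) :
  WH_BPB U v (HvK U v : set (E -> F)).
Proof.
move=> eps /andP[eps0 eps1]; have [_ v0] := hv.
(* The final distance is at most [3 * r + 2 * (eps / 8 + (1 - n))] with [r = eps / 12] and
   [1 - n < eta < eps / 8], hence below [3 / 4] of [eps]. *)
have eps8 : 0 < eps / 8 < 1 by apply/andP; split; lra.
have [eta /andP[eta0 eta_lt] BPB] := hBPB _ eps8.
exists eta; first by apply/andP; split; lra.
move=> f lambda z [[fhol fub] fcpt] nf lambda1 Uz hz.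
have U0 : U !=set0 by exists z.
have vf1 w : U w -> v w * rnorm (f w) <= 1 by move=> Uw; rewrite -nf; exact: le_vnorm.
have fz0 : f z != 0.
  by apply: contraTneq hz => ->; rewrite rnorm0 mulr0 -leNgt; lra.
(* [phi] depends on [f] and [z], while [eta] is already fixed; norming [f z] makes [phi (f z)] as
   large as [f z]. *)
have [phi [e [phi_e phifz]]] := lindenstrauss_L_summand hF fz0.
have [tphi nphi _ _ _] := phi_e.
have phi_le x : rnorm (phi x) <= rnorm x.
  by have := le_opnorm x tphi; rewrite nphi mul1r.
pose g : E -> R[i]^o := fun w => phi (f w).
have vg w : U w -> v w * rnorm (g w) <= v w * rnorm (f w).
  by move=> Uw; apply: ler_wpM2l; [exact/ltW/v0|exact: phi_le].
have vg1 w : U w -> v w * rnorm (g w) <= 1.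
  by move=> Uw; exact: le_trans (vg w Uw) (vf1 w Uw).
have gub : has_ubound (vvalues U v g) := vvalues_ubound vg1.
have ghol : holomorphic_on U g.
  by move=> w Uw; exact: (differentiable_comp (fhol w Uw) (topdual_differentiable (f w) tphi)).
pose n := vnorm U v g.
have n1 : n <= 1 by exact: vnorm_le.
have gz : v z * rnorm (g z) = v z * rnorm (f z).
  by rewrite /g phifz rnormC ger0_norm// rnorm_ge0.
have n_gt : 1 - eta < n by rewrite (lt_le_trans hz)// -gz le_vnorm.
have n0 : 0 < n by lra.
have ni0 : 0 < n^-1 by rewrite invr_gt0.
have [g1ub ng1] := vnormZ U0 ni0 gub.
set g1 := n^-1%:C *: g in g1ub ng1.
have g1E w : v w * rnorm (g1 w) = n^-1 * (v w * rnorm (g w)).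
  by rewrite -[g1 w]/(n^-1%:C *: g w) rnormZr gtr0_norm// mulrCA.
have g1hol : holomorphic_on U g1.
  by move=> w Uw; exact: (@differentiableZ _ _ _ g (n^-1)%:C w (ghol w Uw)).
(* Dividing by [n <= 1] does not decrease the value at [z], so [g1] meets the threshold [1 - eta]
   there. *)
have [||g0 [lambda0 [z0 [[[g0hol g0ub] ng0 lambda01 Uz0] g0z0 dg dd]]]] :=
    BPB g1 lambda z (conj g1hol g1ub) _ lambda1 Uz.
- by rewrite ng1 -/n mulVf// gt_eqF.
- rewrite g1E gz (lt_le_trans hz)// ler_peMl//; last by rewrite invf_ge1.
  by rewrite mulr_ge0 ?rnorm_ge0// ltW// v0.
pose disc : set R[i]^o := [set b | rnorm b <= 1].
pose vf := [set (v w)%:C *: f w | w in U].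
pose K : set (F * R[i]^o) := closure vf `*` disc.
have cK : compact K.
  by apply: compact_setX; [rewrite -precompactE|exact: compact_disc].
have K1 x b : K (x, b) -> rnorm x <= 1 /\ rnorm b <= 1.
  move=> [/= vfx b1]; split=> //.
  have : closure vf `<=` [set x | rnorm x <= 1].
    rewrite [X in _ `<=` X](closure_id _).1; last exact: closed_rnorm_le.
    apply: closure_subset => _ [w Uw <-] /=.
    by rewrite rnormZr gtr0_norm ?v0// vf1.
  exact.
have r0 : 0 < eps / 12 by lra.
have r2 : eps / 12 <= 2^-1 by lra.
have [y [q [phiy phiq hS]]] := L_summand_contractive_lift phi_e cK r0 r2 K1.
set r := eps / 12 in r0 r2 hS.
pose f0 w : F := (1 - r)%:C *: (f w - phi (f w) *: y) + g0 w *: q.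
have vg0 w : U w -> v w * rnorm (g0 w) <= 1.
  by move=> Uw; rewrite -ng0; exact: le_vnorm.
have inK w : U w -> K ((v w)%:C *: f w, (v w)%:C * g0 w).
  move=> Uw; split; first by apply: subset_closure; exists w.
  by rewrite /disc /= rnormM rnormC gtr0_norm ?v0// vg0.
(* The correction is homogeneous in the pair, so the weight factors out and [f0] is defined without
   it. *)
have SE w : (1 - r)%:C *: ((v w)%:C *: f w - phi ((v w)%:C *: f w) *: y) +
    ((v w)%:C * g0 w) *: q = (v w)%:C *: f0 w.
  rewrite topdualZ// /f0 [RHS]scalerDr; congr (_ + _); last by rewrite scalerA.
  by rewrite -[(_ * phi _) *: y]scalerA -scalerBr !scalerA mulrC.
have vf0 w : U w -> v w * rnorm (f0 w) <= 1.
  move=> Uw; have [h _] := hS _ _ (inK w Uw).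
  by move: h; rewrite SE rnormZr gtr0_norm ?v0.
have f0ub : has_ubound (vvalues U v f0) := vvalues_ubound vf0.
have phif0 w : phi (f0 w) = g0 w.
  rewrite /f0 (topdualD _ _ tphi) (topdualZ (1 - r)%:C _ tphi) (topdualB _ _ tphi).
  rewrite (topdualZ (phi (f w)) y tphi) (topdualZ (g0 w) q tphi) phiy phiq.
  by rewrite !mulr1 subrr mulr0 add0r.
have f0z0 : v z0 * rnorm (f0 z0) = 1.
  apply/eqP; rewrite eq_le vf0//= -g0z0 -phif0.
  by apply: ler_wpM2l; [exact/ltW/v0|exact: phi_le].
exists f0, lambda0, z0; split=> //.
- split=> //.
    split; first split=> //.
      exact: holomorphic_on_correction tphi fhol g0hol.
    (* The weighted range of [f0] lies in the image of the compact [K] under the correction. *)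
    pose S (p : F * R[i]^o) := (1 - r)%:C *: (p.1 - phi p.1 *: y) + p.2 *: q.
    have cS : compact (S @` K).
      apply: continuous_compact => //; apply: continuous_subspaceT.
      exact: (@correction_continuous _ _ _ _ _ _ tphi).
    apply: precompact_subset (compact_precompact _ cS); last exact: norm_hausdorff.
    move=> _ [w Uw <-]; exists ((v w)%:C *: f w, (v w)%:C * g0 w); first exact: inK.
    by rewrite -SE.
  apply/eqP; rewrite eq_le vnorm_le//=.
  by rewrite -f0z0 le_vnorm.
- apply: (@le_lt_trans _ _ (3 * r + 2 * (eps / 8 + (1 - n)))); last by rewrite /r; lra.
  apply: vnorm_le => // w Uw.
  have [_ h] := hS _ _ (inK w Uw).
  have -> : v w * rnorm ((f - f0) w) = rnorm ((v w)%:C *: f w - (v w)%:C *: f0 w).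
    by rewrite -scalerBr rnormZr gtr0_norm// v0.
  rewrite -SE (le_trans h)// lerD2l ler_pM2l//.
  (* [g0] is compared with [g] through [g1]: the scalar property bounds one part by [eps / 8], and
     normalisation costs at most [(n^-1 - 1) * n = 1 - n]. *)
  have -> : (v w)%:C * g0 w - phi ((v w)%:C *: f w) =
      (v w)%:C * (g1 w - g w : R[i]^o) - (v w)%:C * (g1 w - g0 w : R[i]^o).
    by rewrite topdualZ// /g; ring.
  rewrite (le_trans (rnormB _ _))// !rnormM rnormC gtr0_norm ?v0// addrC lerD//.
    rewrite ltW// (le_lt_trans _ dg)//.
    apply: (@le_vnorm _ _ _ U v (g1 - g0)) => //.
    (* A crude bound, to ensure that the supremum defining the norm is finite. *)
    apply: (vvalues_ubound (M := 1 + 1)) => x Ux.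
    rewrite (@le_trans _ _ (v x * (rnorm (g1 x) + rnorm (g0 x))))//.
      by apply: ler_wpM2l; [exact/ltW/v0|exact: rnormB].
    rewrite mulrDr lerD// ?vg0//.
    by rewrite (le_trans (le_vnorm g1ub Ux))// ng1 -/n mulVf// gt_eqF.
  have -> : g1 w - g w = (n^-1 - 1)%:C * g w.
    by rewrite rmorphB rmorph1 mulrBl mul1r.
  have ni1 : 0 <= n^-1 - 1 by rewrite subr_ge0 invf_ge1.
  rewrite rnormM rnormC ger0_norm// mulrCA.
  rewrite (@le_trans _ _ ((n^-1 - 1) * n))//; last by rewrite mulrBl mulVf ?gt_eqF// mul1r.
  by rewrite ler_wpM2l// le_vnorm.
- by apply: lt_trans dd _; lra.
Qed.
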